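(* Let $N\ge2$, let $G(t_N)$ be the $N$-graph associated to an $N$-triangle $t_N$, and let $k$ be a field. The flag moduli space of $G(t_N)$ is a $\binom{N-1}{2}$-dimensional torus, i.e. $$\mathcal{M}(t_N,G(t_N);k)\cong(k^* )^{\binom{N-1}{2}}.$$
   Context: **$N$-graphs.** An $N$-graph $G$ on a smooth surface $C$ is a set $\{G_i\}_{1\le i\le N-1}$ of embedded trivalent graphs $G_i\subseteq C$ (possibly empty or disconnected, edges may end on the boundary) such that $G_i$ and $G_{i+1}$ intersect only at hexagonal points, i.e. at isolated common vertices where the six incident half-edges alternately belong to $G_i$ and $G_{i+1}$; $G_i,G_j$ with $|i-j|\ge2$ may intersect anywhere. Edges of $G_i$ are $\tau_i$-edges. A face is the closure of a component of $C\setminus G$. **The $N$-graph $G(t_N)$.** Realize the triangle as $t_N=\{(x,y,z)\in\mathbb{R}^3: x+y+z=N-1,\ x,y,z\ge0\}$. Let $\vartheta_i$ be the set of points of $t_N$ all of whose coordinates lie in $\mathbb{Z}_{\ge0}+\frac{i}{3}$. The graph $G_i$, $1\le i\le N-1$, is the piece of a regular hexagonal lattice whose vertices are exactly the points of $\vartheta_i\cup\vartheta_{i+1}$: each point of $\vartheta_i$ has three edges of $G_i$, in the directions $(\frac13,\frac13,-\frac23)$, $(\frac13,-\frac23,\frac13)$, $(-\frac23,\frac13,\frac13)$, each ending at the neighboring point of $\vartheta_{i+1}$ if that point exists, and otherwise extended straight to the boundary of $t_N$. Then $G_i\cap G_{i+1}=\vartheta_{i+1}$ consists of hexagonal points, and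 the $\binom N2$ points of $\vartheta_1$ are the remaining trivalent vertices, all in $G_1$. (Equivalently: subdivide the triangle of side length $N$ into $N^2$ unit triangles, put a $\tau_1$-trivalent vertex dual to each of the $\binom N2$ upward-pointing ones, let edges grow, and insert a $(\tau_i,\tau_{i+1})$-hexagonal vertex whenever three $\tau_i$-edges collide.) **Flag moduli space.** $t_N$ is regarded as a disk. $\widetilde{\mathcal{M}}(t_N,G;k)$ parametrizes assignments of a complete flag $\mathcal{F}^\bullet(F)$ in $k^N$ to each face $F$ of $G$ such that for faces $F_1,F_2$ sharing a $\tau_i$-edge, $\mathcal{F}^j(F_1)=\mathcal{F}^j(F_2)$ for all $j\ne i$ and $\mathcal{F}^i(F_1)\ne\mathcal{F}^i(F_2)$. $\mathcal{M}(t_N,G;k)=\widetilde{\mathcal{M}}(t_N,G;k)/\mathrm{PGL}_N$ is the quotient (stack) by the diagonal action.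
   Formalization: In the given coordinates edges of G_i and G_j with |i-j|≥2 can overlap (from N=4), making the flag condition contradictory; on a shared segment it is read colour by colour: F^i differ if the segment lies in G_i, agree if it is disjoint from G_i. *)

(* Defs.v *)
From HB Require Import structures.
From mathcomp Require Import all_boot all_order all_algebra.
From mathcomp Require Import all_classical all_reals all_analysis.

Set Implicit Arguments.
Unset Strict Implicit.
Unset Printing Implicit Defensive.

Import Order.TTheory GRing.Theory Num.Theory.
Import numFieldNormedType.Exports.

Local Open Scope classical_set_scope.
Local Open Scope ring_scope.

Section Triangle.
Variables (R : realType) (N : nat).

Local Notation point := 'rV[R]_3.

Definition triangle : set point :=
  [set p | (forall j, 0 <= p 0 j) /\ \sum_j p 0 j = N%:R - 1].

Definition theta (i : nat) : set point :=
  [set p | triangle p /\ forall j, exists n : nat, p 0 j = n%:R + i%:R / 3].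

(* -2/3 in position m, 1/3 in the two other positions *)
Definition dir (m : 'I_3) : point := \row_j (3^-1 - (j == m)%:R).

Definition segment (a b : point) : set point :=
  [set a + t *: (b - a) | t in [set t : R | 0 <= t <= 1]].

Definition ray (a d : point) : set point :=
  [set a + t *: d | t in [set t : R | 0 <= t]].

Definition edge (i : nat) (p : point) (m : 'I_3) : set point :=
  [set x | (theta i.+1 (p + dir m) /\ segment p (p + dir m) x) \/
           (~ theta i.+1 (p + dir m) /\ triangle x /\ ray p (dir m) x)].

(* Only meaningful for 0 < i < N. *)
Definition layer (i : nat) : set point :=
  [set x | exists p m, theta i p /\ edge i p m x].

Definition Ngraph : set point :=
  [set x | exists2 i, (0 < i < N)%N & layer i x].

Definition is_face (F : set point) : Prop :=
  exists2 x, (triangle `\` Ngraph) x &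
    F = closure (connected_component (triangle `\` Ngraph) x).

Definition face : Type := {F : set point | is_face F}.

Definition share_segment (F1 F2 : face) (a b : point) : Prop :=
  [/\ F1 <> F2, a <> b & segment a b `<=` sval F1 `&` sval F2].

End Triangle.

Section Flags.
Variables (A : comUnitRingType) (N : nat).

Definition submodule (P : set 'cV[A]_N) : Prop :=
  [/\ P 0, forall v w, P v -> P w -> P (v + w) & forall a v, P v -> P (a *: v)].

Definition flag_data : Type := 'I_N.+1 -> set 'cV[A]_N.

(* The quotients F^(i+1)/F^i are free of rank one.  Over a field these are the
   complete flags 0 = F^0 < F^1 < ... < F^N = A^N with dim F^i = i; over a local
   ring they are all the points of the flag variety, and over any ring every
   point of the flag variety is of this form Zariski-locally. *)
Definition complete_flag (F : flag_data) : Prop :=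
  [/\ F ord0 = [set 0],
      F ord_max = setT,
      forall i, submodule (F i) &
      forall i j : 'I_N.+1, j = i.+1 :> nat ->
        F i `<=` F j /\
        exists2 v, F j v &
          forall w, F j w -> exists! a : A, F i (w - a *: v)].

Definition gl_act (g : 'M[A]_N) (F : flag_data) : flag_data :=
  fun i => [set g *m v | v in F i].

End Flags.

Section BaseChange.
Variables (A B : comUnitRingType) (phi : A -> B) (N : nat).

Definition base_change (P : set 'cV[A]_N) : set 'cV[B]_N :=
  [set w | exists n (c : 'I_n -> B) (v : 'I_n -> 'cV[A]_N),
      (forall l, P (v l)) /\ w = \sum_l c l *: map_mx phi (v l)].

End BaseChange.

(* P and Q differ at every point of Spec A.  When A is a field and P, Q are
   subspaces, this just says P <> Q. *)
Definition distinct_everywhere (A : comUnitRingType) (N : nat)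
    (P Q : set 'cV[A]_N) : Prop :=
  forall (L : fieldType) (phi : {rmorphism A -> L}),
    base_change phi P <> base_change phi Q.

Section Moduli.
Variables (R : realType) (N : nat).

Definition flag_assignment (A : comUnitRingType) : Type :=
  face R N -> flag_data A N.

(* The A-points of the framed moduli space.  In this drawing G_i and G_j can
   coincide along segments when |i - j| >= 2 (from N = 4 on); such a segment
   belongs to edges of several colours, each of which changes its own step of
   the flag.  This is what one gets by pushing the overlapping edges slightly
   apart, the flags in the thin faces in between being then determined by the
   others. *)
Definition framed_moduli (A : comUnitRingType) : set (flag_assignment A) :=
  [set x | (forall F, complete_flag (x F)) /\
    forall F1 F2 a b, share_segment F1 F2 a b ->
      forall i : 'I_N.+1, (0 < i < N)%N ->
        (segment a b `<=` layer N i -> distinct_everywhere (x F1 i) (x F2 i)) /\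
        (segment a b `&` layer N i = set0 -> x F1 i = x F2 i)].

Definition assignment_act (A : comUnitRingType) (g : 'M[A]_N)
    (x : flag_assignment A) : flag_assignment A :=
  fun F => gl_act g (x F).

Definition assignment_base_change (A B : comUnitRingType) (phi : A -> B)
    (x : flag_assignment A) : flag_assignment B :=
  fun F i => base_change phi (x F i).

(* Representatives of the morphisms x -> y in the action groupoid of PGL_N. *)
Definition action_hom (A : comUnitRingType) (x y : flag_assignment A) :
    set 'M[A]_N :=
  [set g | g \in unitmx /\ assignment_act g x = y].

End Moduli.

Definition pgl_eq (A : comUnitRingType) (N : nat) (g h : 'M[A]_N) : Prop :=
  exists2 a : A, a \is a GRing.unit & h = a *: g.

Definition torus (A : comUnitRingType) (d : nat) : set 'rV[A]_d :=
  [set t | forall j, t 0 j \is a GRing.unit].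

(* f is an isomorphism from the quotient stack of the framed moduli space by
   PGL_N to the d-dimensional torus over k, on functors of points on
   commutative k-algebras: f is natural, and for every A it is an equivalence
   from the action groupoid of PGL_N on the A-points of the framed moduli space
   to the set of A-points of the torus.  The action groupoids are formed with
   flags having free quotients and with GL_N(A)/A^*; this changes neither their
   values on local A nor the associated stack, and at A = k it gives the orbit
   set of the assignments of flags in k^N. *)
Definition quotient_iso_torus (R : realType) (N : nat) (k : fieldType) (d : nat)
    (f : forall A : comUnitAlgType k, flag_assignment R N A -> 'rV[A]_d) : Prop :=
  [/\ forall (A : comUnitAlgType k) x, framed_moduli x -> torus (f A x),
      forall (A B : comUnitAlgType k) (phi : {lrmorphism A -> B}) x,
        framed_moduli x ->
        f B (assignment_base_change phi x) = map_mx phi (f A x),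
      forall (A : comUnitAlgType k) x y, framed_moduli x -> framed_moduli y ->
        (f A x = f A y <-> action_hom x y !=set0),
      forall (A : comUnitAlgType k) (x y : flag_assignment R N A) g h,
        framed_moduli x -> framed_moduli y ->
        action_hom x y g -> action_hom x y h -> pgl_eq g h &
      forall (A : comUnitAlgType k) t, torus t ->
        exists2 x, framed_moduli x & f A x = t].

(* Main.v *)
(* The layer G_i is the Voronoi diagram of theta_(i-1), so its complementary
   regions are indexed by the exponents n = (a, b, c) with a + b + c = N - i, and
   an assignment of flags to the faces amounts to subspaces V_n of dimension
   N - |n|, with V_(n + e_j) in V_n, the three V_(n + e_j) being pairwise distinct.
   Each V_n is then spanned by the lines V_v with |v| = N - 1 and v >= n, and each
   upward triangle of such lines is one linear relation with unit coefficients.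
   Rescaling the generators of the lines one row after the other brings the
   relations to the form l_(b,c+1) = l_(b,c) - t_(b,c) l_(b+1,c), with
   t_(b,0) = 1.  The first row is then a basis, unique up to a common scalar, and
   the t_(b,c) with c > 0 and b + c + 1 < N, binomial(N-1, 2) in number, are free
   coordinates.  Over an arbitrary ring, the sum of two hyperplanes of V_n that
   differ at all points of the spectrum is V_n, as one sees modulo a maximal
   ideal. *)
Require Import Defs.
From HB Require Import structures.
From mathcomp Require Import all_boot all_order all_algebra.
From mathcomp Require Import all_classical all_reals all_analysis.
From mathcomp Require Import zify ring lra.

Set Implicit Arguments.
Unset Strict Implicit.
Unset Printing Implicit Defensive.

Import Order.TTheory GRing.Theory Num.Theory.
Import numFieldNormedType.Exports.

Local Open Scope classical_set_scope.
Local Open Scope ring_scope.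

(** * Cells *)

(** The subspace F^i must be shown to depend only on the cell of level i, although the other layers
    cut that cell into many faces and the hypothesis compares only faces sharing a nondegenerate
    segment. All layers lie on the walls x_j - x_k in Z, and the faces that come close to an
    interior point on at most one wall share a short segment through it. So the argument follows a
    segment inside the cell that meets no point of two walls, and concludes by connectedness of
    [0,1]. In the standard frame the vector of (b, c) is supported on the coordinates b to b + c,
    with 1 in the first place and a unit in the last. Reading off coordinates replaces the dimension
    counts available over a field, and shows that a matrix carrying one normal form to another is
    scalar. This rigidity yields at once that the coordinates are well defined, that they are
    natural in the ring, and that stabilizers in PGL_N are trivial. *)

Lemma sum_ord3 (V : nmodType) (f : 'I_3 -> V) (j k m : 'I_3) :
  j != k -> j != m -> k != m -> \sum_i f i = f j + f k + f m.
Proof.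
move=> jk jm km; rewrite (bigD1 j) //= (bigD1 k) /=; last by rewrite eq_sym.
rewrite (bigD1 m) /=; last by rewrite ![m == _]eq_sym jm.
rewrite big1 ?addr0 ?addrA // => i.
by case: i j k m jk jm km => [[|[|[|]]] // ?] [[|[|[|]]] // ?] [[|[|[|]]] // ?]
  [[|[|[|]]] // ?].
Qed.

Lemma ord3_third (j k : 'I_3) : j != k -> exists m, (j != m) && (k != m).
Proof.
case: j k => [[|[|[|]]] // ?] [[|[|[|]]] // ?] // _;
  by [exists (@Ordinal 3 0 isT) | exists (@Ordinal 3 1 isT)
     | exists (@Ordinal 3 2 isT)].
Qed.

Lemma ord3_cases (j k m i : 'I_3) : j != k -> j != m -> k != m ->
  [\/ i = j, i = k | i = m].
Proof.
move=> jk jm km; have [->|ij] := eqVneq i j; first exact: Or31.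
have [->|ik] := eqVneq i k; first exact: Or32.
apply: Or33; apply/eqP; move: jk jm km ij ik.
by case: i j k m => [[|[|[|]]] // ?] [[|[|[|]]] // ?] [[|[|[|]]] // ?]
  [[|[|[|]]] // ?].
Qed.

Section Cells.
Variables (R : realType).
Local Notation point := 'rV[R]_3.
Implicit Types (n : 'I_3 -> nat) (p q : point) (j k m : 'I_3).

Definition deg n : nat := (\sum_j n j)%N.

Definition incr n j : 'I_3 -> nat := fun i => (n i + (i == j))%N.

Lemma deg_incr n j : deg (incr n j) = (deg n).+1.
Proof.
rewrite /deg /incr big_split /= -[RHS]addn1; congr addn.
by rewrite (bigD1 j) //= big1 ?eqxx // => i /negPf ->.
Qed.

Lemma natr_deg n j k m : j != k -> j != m -> k != m ->
  (deg n)%:R = (n j)%:R + (n k)%:R + (n m)%:R :> R.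
Proof. by move=> *; rewrite /deg natr_sum (@sum_ord3 _ _ j k m). Qed.

Lemma deg3 n j k m : j != k -> j != m -> k != m ->
  deg n = (n j + n k + n m)%N.
Proof. by move=> *; rewrite /deg (@sum_ord3 _ n j k m). Qed.

(* The cells of the points n + (i-1)/3, for deg n = N - i, are the cells of the
   Voronoi diagram of theta_(i-1); the layer G_i is that diagram. *)
Definition ocell n p := forall j k, j != k -> (0 < n k)%N ->
  p 0 j - p 0 k < (n j)%:R - (n k)%:R + 1.

(** Each inequality is the bisector between n and the neighbouring exponent n + e_j - e_k, which
    exists only if [0 < n k]. The shift (i-1)/3 cancels in differences, so all levels use the same
    functions of p. *)
Definition ccell n p := forall j k, j != k -> (0 < n k)%N ->
  p 0 j - p 0 k <= (n j)%:R - (n k)%:R + 1.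

Lemma ocellW n p : ocell n p -> ccell n p.
Proof. by move=> h j k jk nk; apply/ltW/h. Qed.

(** Greedy construction: incrementing a coordinate where p_i - n_i is largest keeps p in the closed
    cell. *)
Lemma ccell_exists d p : exists2 n, deg n = d & ccell n p.
Proof.
elim: d => [|d [n dn cn]].
  by exists (fun=> 0%N) => //; rewrite /deg big1.
have [j jmax] : exists j, forall i, p 0 i - (n i)%:R <= p 0 j - (n j)%:R.
  have [j _ jmax] := @arg_maxP _ R _ (@ord0 2) xpredT
    (fun i => p 0 i - (n i)%:R) isT.
  by exists j => i; exact: jmax.
exists (incr n j); first by rewrite deg_incr dn.
move=> a b ab; rewrite /incr; have [bj|bj] := eqVneq b j.
  move=> _; rewrite bj in ab *; rewrite (negPf ab) addn0 addn1 -natr1; move: (jmax a); lra.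
rewrite addn0 => nb; have := cn _ _ ab nb; rewrite natrD.
have := ler0n R (a == j); lra.
Qed.

Lemma deg_neq n n' : deg n = deg n' -> n <> n' ->
  exists j k m, [/\ j != k, j != m, k != m, (n j < n' j)%N & (n' k < n k)%N].
Proof.
move=> dn nn'.
have [j jlt] : exists j, (n j < n' j)%N.
  apply: contrapT => /forallNP h; apply: nn'.
  have le i : (n' i <= n i)%N by have := h i; lia.
  apply/funext => i; apply/eqP; move: (@leqif_sum _ xpredT
    (fun i => n' i == n i) n' n) => /(_ (fun i _ => leqif_eq (le i))) [_].
  by rewrite -/(deg n) -/(deg n') dn eqxx => /esym /forallP/(_ i)/eqP ->.
have [k klt] : exists k, (n' k < n k)%N.
  apply: contrapT => /forallNP h; apply: nn'.
  have le i : (n i <= n' i)%N by have := h i; lia.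
  apply/funext => i; apply/eqP; move: (@leqif_sum _ xpredT
    (fun i => n i == n' i) n n') => /(_ (fun i _ => leqif_eq (le i))) [_].
  by rewrite -/(deg n) -/(deg n') dn eqxx => /esym /forallP/(_ i).
have jk : j != k by apply/eqP => jk; move: jlt klt; rewrite jk; lia.
by have [m /andP[jm km]] := ord3_third jk; exists j, k, m.
Qed.

Lemma ltn_nat1 a b : (a < b)%N -> a%:R + 1 <= b%:R :> R.
Proof. by rewrite natr1 ler_nat. Qed.

(** Adding the wall inequalities of a coordinate j that grows and a coordinate k that drops leaves
    room for exactly one unit in each, so both are equalities. *)
Lemma ccell_adjacent n n' p : deg n = deg n' -> n <> n' ->
  ccell n p -> ccell n' p ->
  exists j k m, [/\ [&& j != k, j != m & k != m],
    n' j = (n j).+1, n k = (n' k).+1, n' m = n m &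
    p 0 j - p 0 k = (n j)%:R - (n k)%:R + 1].
Proof.
move=> dn nn' cn cn'; have [j [k [m [jk jm km jlt klt]]]] := deg_neq dn nn'.
have kj : k != j by rewrite eq_sym.
have := cn j k jk (leq_ltn_trans (leq0n _) klt).
have := cn' k j kj (leq_ltn_trans (leq0n _) jlt).
have := ltn_nat1 jlt; have := ltn_nat1 klt => h1 h2 h3 h4.
have ej : (n' j = (n j).+1)%N.
  by apply/eqP; rewrite -(eqr_nat R) -natr1; apply/eqP; lra.
have ek : (n k = (n' k).+1)%N.
  by apply/eqP; rewrite -(eqr_nat R) -natr1; apply/eqP; lra.
exists j, k, m; split => //; first by rewrite jk jm.
  by move: dn; rewrite !(deg3 _ jk jm km); lia.
lra.
Qed.

Lemma ocell_unique n n' p : deg n = deg n' -> ocell n p -> ccell n' p -> n = n'.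
Proof.
move=> dn cn cn'; apply: contrapT => nn'.
have [j [k [m [/and3P[jk _ _] nj nk _]]]] :=
  ccell_adjacent dn nn' (ocellW cn) cn'.
by have := cn j k jk; rewrite nk => /(_ isT); lra.
Qed.

Lemma ccell_boundary n p : ccell n p -> ~ ocell n p ->
  exists j k m, [/\ [&& j != k, j != m & k != m], (0 < n k)%N &
    p 0 j - p 0 k = (n j)%:R - (n k)%:R + 1].
Proof.
move=> cn non; apply: contrapT => h; apply: non => j k jk nk.
rewrite lt_neqAle cn // andbT; apply/eqP => e; apply: h.
by have [m /andP[jm km]] := ord3_third jk; exists j, k, m; split; rewrite ?jk ?jm.
Qed.

(** This nesting makes the subspaces of the model into flags. If a coordinate dropped from n to n',
    another would grow, and the two strict wall inequalities would add up to 0 < 0. *)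
Lemma ocell_nested n n' p : deg n' = (deg n).+1 -> ocell n p -> ocell n' p ->
  exists j, n' = incr n j.
Proof.
move=> dn cn cn'.
have le i : (n i <= n' i)%N.
  rewrite leqNgt; apply/negP => ilt.
  have [j jlt] : exists j, (n j < n' j)%N.
    apply: contrapT => /forallNP h.
    have : (deg n' <= deg n)%N by apply: leq_sum => j _; have := h j; lia.
    by rewrite dn ltnn.
  have ij : i != j by apply/eqP => ij; move: jlt ilt; rewrite ij; lia.
  have ji : j != i by rewrite eq_sym.
  have := cn j i ji (leq_ltn_trans (leq0n _) ilt).
  have := cn' i j ij (leq_ltn_trans (leq0n _) jlt).
  by have := ltn_nat1 jlt; have := ltn_nat1 ilt; lra.
have [j jlt] : exists j, (n j < n' j)%N.
  apply: contrapT => /forallNP h.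
  have : (deg n' <= deg n)%N by apply: leq_sum => j _; have := h j; lia.
  by rewrite dn ltnn.
exists j; apply/funext => i.
have le' a : (incr n j a <= n' a)%N.
  by rewrite /incr; case: eqVneq => [->|_]; have := le a; lia.
move: (@leqif_sum _ xpredT (fun i => incr n j i == n' i) (incr n j) n').
move=> /(_ (fun i _ => leqif_eq (le' i))) [_].
rewrite -/(deg n') -/(deg (incr n j)) deg_incr dn eqxx.
by move=> /esym /forallP/(_ i)/eqP ->.
Qed.

Lemma ocell_conv n p q (t : R) : 0 < t -> t <= 1 -> ccell n p -> ocell n q ->
  ocell n (p + t *: (q - p)).
Proof.
move=> t0 t1 cp cq j k jk nk; rewrite !mxE.
have := cp j k jk nk; have := cq j k jk nk; nra.
Qed.

Lemma ccell_conv n p q (t : R) : 0 <= t -> t <= 1 -> ccell n p -> ccell n q ->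
  ccell n (p + t *: (q - p)).
Proof.
move=> t0 t1 cp cq j k jk nk; rewrite !mxE.
have := cp j k jk nk; have := cq j k jk nk; nra.
Qed.

Lemma triangle_conv N p q (t : R) : 0 <= t -> t <= 1 ->
  triangle N p -> triangle N q -> triangle N (p + t *: (q - p)).
Proof.
move=> t0 t1 [p0 ps] [q0 qs]; split => [j|].
  by rewrite !mxE; have := p0 j; have := q0 j; nra.
under eq_bigr do rewrite !mxE.
rewrite big_split /= -mulr_sumr sumrB ps qs; ring.
Qed.

End Cells.

(** * The layers and the faces *)

Section Layers.
Variables (R : realType) (N : nat).
Local Notation point := 'rV[R]_3.
Implicit Types (n : 'I_3 -> nat) (p q y z w : point) (j k m : 'I_3).

Definition node n (c : R) : point := \row_j ((n j)%:R + c).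

Lemma ord3_others m : exists j k, [&& j != k, j != m & k != m].
Proof.
have [j jm] : exists j : 'I_3, j != m.
  by case: m => [[|[|[|]]] // ?]; [exists (@Ordinal 3 1 isT)
    | exists (@Ordinal 3 0 isT) | exists (@Ordinal 3 0 isT)].
have [k /andP[jk mk]] := ord3_third jm.
by exists j, k; rewrite jk jm eq_sym mk.
Qed.

Lemma triangle_node n i : (deg n + i).+1 = N -> triangle N (node n (i%:R / 3)).
Proof.
move=> dn; split=> [j|].
  by rewrite mxE addr_ge0 // divr_ge0.
under eq_bigr do rewrite mxE.
rewrite big_split /= -natr_sum -/(deg n) sumr_const card_ord -dn -(@natr1 R (deg n + i)) natrD.
by rewrite -mulr_natr; lra.
Qed.

Lemma theta_node n i : (deg n + i).+1 = N -> theta N i (node n (i%:R / 3)).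
Proof.
by move=> dn; split; [exact: triangle_node | move=> j; exists (n j); rewrite mxE].
Qed.

Lemma thetaE i p : theta N i p ->
  exists2 n, (deg n + i).+1 = N & p = node n (i%:R / 3).
Proof.
move=> [[_ ps] /choice[n hn]]; exists n; last by apply/rowP => j; rewrite mxE hn.
apply/eqP; rewrite -(eqr_nat R) -(@natr1 R (deg n + i)) natrD; apply/eqP.
move: ps; under eq_bigr do rewrite hn.
rewrite big_split /= -natr_sum -/(deg n) sumr_const card_ord -mulr_natr; lra.
Qed.

(** The edge leaving the node n in direction m separates the cells of n + e_j and n + e_k for the
    two other indices. A length bound is imposed only if [0 < n m], when the edge ends at a vertex
    instead of running to the boundary. *)
Lemma ccell_edge n k m (c t : R) : k != m -> 0 <= t ->
  ((0 < n m)%N -> t <= 1) -> ccell (incr n k) (node n c + t *: dir R m).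
Proof.
move=> km t0 t1 a b ab; rewrite /incr !mxE !natrD.
have ak := ler0n R (a == k); have am := ler0n R (a == m).
have tam := mulr_ge0 t0 am.
have [bm|bm] := eqVneq b m.
  rewrite bm in ab *; rewrite (negPf ab) eq_sym (negPf km) /= addn0 => /t1.
  by nra.
have [bk|bk] := eqVneq b k; last by rewrite /=; nra.
by rewrite bk in ab *; rewrite (negPf ab) /=; nra.
Qed.

(** The neighbour has m-th coordinate (n_m - 1) + (i+1)/3, its other coordinates being n_a +
    (i+1)/3. *)
Lemma theta_step n i m : (deg n + i).+1 = N ->
  theta N i.+1 (node n (i%:R / 3) + dir R m) <-> (0 < n m)%N.
Proof.
move=> dn; split=> [[_ /(_ m)[l]]|nm].
  rewrite !mxE eqxx -(@natr1 R i) mulr1n => e; rewrite -(ltr_nat R).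
  by have := ler0n R l; lra.
pose n' := (fun a => n a - (a == m))%N.
have nE : n = incr n' m.
  by apply/funext => a; rewrite /incr /n'; case: eqVneq => [->|_]; lia.
have -> : node n (i%:R / 3) + dir R m = node n' (i.+1%:R / 3).
  apply/rowP => a; rewrite !mxE -(@natr1 R i) {1}nE /incr natrD.
  by rewrite /=; lra.
by apply: theta_node; rewrite -dn nE deg_incr addnS.
Qed.

Lemma layer_cells i p : layer N i p -> triangle N p /\
  exists n j k m, [/\ [&& j != k, j != m & k != m], (deg n + i).+1 = N,
    ccell (incr n j) p & ccell (incr n k) p].
Proof.
move=> [q [m [hq]]]; have [n dn ->] := thetaE hq => e.
have {e} : triangle N p /\ exists t, [/\ 0 <= t, (0 < n m)%N -> t <= 1 &
    p = node n (i%:R / 3) + t *: dir R m].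
  case: e => [[th [t /andP[t0 t1] <-]]|[th [tp [t t0 pE]]]].
    split; last by exists t; split; rewrite ?[_ + dir _ _]addrC ?addrK ?[dir _ _ + _]addrC.
    apply: triangle_conv => //; first exact: triangle_node.
    by case: th.
  split; first exact: tp.
  exists t; split; first exact: t0; last by rewrite pE.
  by move=> nm; case: th; apply/(theta_step m dn).
move=> [tp [t [t0 t1 pE]]]; split; first exact: tp.
have [j [k /and3P[jk jm km]]] := ord3_others m.
exists n, j, k, m; rewrite pE jk jm km; split => //; exact: ccell_edge.
Qed.

Lemma cells_layer i n p : (0 < i < N)%N -> (deg n + i)%N = N ->
  triangle N p -> ccell n p -> ~ ocell n p -> layer N i p.
Proof.
move=> /andP[i0 _] dn tp cn non.
have [j [k [m [/and3P[jk jm km] nk e]]]] := ccell_boundary cn non.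
have kj : k != j by rewrite eq_sym.
have mk : m != k by rewrite eq_sym.
(* [n0] is the node from which the edge starts: the wall separates n0 + e_k = n from n0 + e_j. *)
pose n0 := (fun a => n a - (a == k))%N.
have nE : n = incr n0 k.
  by apply/funext => a; rewrite /incr /n0; case: eqVneq => [->|_]; lia.
have d0 : (deg n0 + i).+1 = N by rewrite -dn nE deg_incr.
have n0j : n0 j = n j by rewrite /n0 (negPf jk) subn0.
have n0m : n0 m = n m by rewrite /n0 (negPf mk) subn0.
have n0k : (n0 k).+1 = n k by rewrite /n0 eqxx; lia.
have mk' := cn m k mk nk.
have ps : p 0 j + p 0 k + p 0 m = (n j)%:R + (n k)%:R + (n m)%:R + i%:R - 1.
  by have [_] := tp; rewrite (sum_ord3 _ jk jm km) -dn natrD (natr_deg _ _ jk jm km).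
exists (node n0 (i%:R / 3)), m; split; first exact: theta_node.
(* Solves the m-th coordinate of the edge equation, [dir R m] having entry -2/3 there. *)
pose t := (3 / 2) * ((n0 m)%:R + i%:R / 3 - p 0 m).
have t0 : 0 <= t by rewrite /t n0m; lra.
have pE : p = node n0 (i%:R / 3) + t *: dir R m.
  apply/rowP => a; rewrite !mxE.
  have n0k' : (n k)%:R = (n0 k)%:R + 1 :> R by rewrite -n0k natr1.
  have [->|->|->] := ord3_cases a jk jm km; rewrite ?eqxx ?(negPf jm) ?(negPf km)
    ?mulr1n ?mulr0n /t ?n0j ?n0m; lra.
have [th|nth] := pselect (theta N i.+1 (node n0 (i%:R / 3) + dir R m)).
  left; split => //; exists t; last by rewrite [_ + dir _ _]addrC addrK.
  apply/andP; split => //.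
  have nm : (0 < n m)%N by rewrite -n0m; apply/(theta_step m d0).
  by have := cn j m jm nm; rewrite /t n0m; lra.
by right; split => //; split => //; exists t.
Qed.

Lemma layerP i p : (0 < i < N)%N -> layer N i p <->
  triangle N p /\ forall n, (deg n + i)%N = N -> ~ ocell n p.
Proof.
move=> hi; split=> [/layer_cells[tp [n [j [k [m [/and3P[jk jm km] dn cj ck]]]]]]|].
  split=> // n' dn' on'.
  have dj : deg n' = deg (incr n j) by rewrite deg_incr; lia.
  have dk : deg n' = deg (incr n k) by rewrite deg_incr; lia.
  have := ocell_unique dk on' ck; rewrite (ocell_unique dj on' cj).
  move=> /(congr1 (fun f => f j)); rewrite /incr eqxx (negPf jk); lia.
move=> [tp non]; have [n dn cn] := ccell_exists (N - i) p.
have dn' : (deg n + i)%N = N by lia.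
exact: (cells_layer hi dn' tp cn (non n dn')).
Qed.

Lemma NgraphPn p : triangle N p -> ~ Ngraph N p ->
  forall d, (0 < d < N)%N -> exists2 n, deg n = d & ocell n p.
Proof.
move=> tp np d hd; apply: contrapT => h; apply: np.
exists (N - d)%N; first by lia.
apply/layerP; first by lia.
split=> // n dn on; apply: h; exists n => //; lia.
Qed.

(* The component of y in the complement of the graph, and its closure. *)
Definition region y : set point := [set z | triangle N z /\
  forall n, (0 < deg n < N)%N -> ocell n y -> ocell n z].

Definition cregion y : set point := [set z | triangle N z /\
  forall n, (0 < deg n < N)%N -> ocell n y -> ccell n z].

Definition off : set point := triangle N `\` Ngraph N.

Lemma off_region y z : off y -> region y z -> off z.
Proof.
move=> [ty ny] [tz yz]; split=> // -[i hi /(layerP _ hi)[_ nz]].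
have hd : (0 < N - i < N)%N by lia.
have [n dn on] := NgraphPn ty ny hd.
by apply: (nz n); [lia | apply: yz => //; lia].
Qed.

Lemma region_refl y : triangle N y -> region y y.
Proof. by move=> ty; split. Qed.

Lemma region_sym y z : off y -> region y z -> region z y.
Proof.
move=> [ty ny] [tz yz]; split=> // n hn onz.
have [n' dn' on'] := NgraphPn ty ny hn.
suff -> : n = n' by [].
by apply: ocell_unique onz (ocellW (yz _ _ on')); lia.
Qed.

Lemma region_eq y z : off y -> region y z -> region y = region z.
Proof.
move=> oy yz; have [_ zy] := region_sym oy yz; have [_ {}yz] := yz.
by apply/seteqP; split=> w [tw h]; split=> // n hn on; apply: h => //;
  [exact: zy | exact: yz].
Qed.

Lemma region_conv y z w (t : R) : cregion y z -> region y w -> 0 < t -> t <= 1 ->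
  region y (z + t *: (w - z)).
Proof.
move=> [tz cz] [tw ow] t0 t1; split; first exact/triangle_conv/tw/tz/t1/ltW.
by move=> n hn on; apply: ocell_conv => //; [exact: cz|exact: ow].
Qed.

Lemma cregion_conv y z w (t : R) : cregion y z -> cregion y w -> 0 <= t -> t <= 1 ->
  cregion y (z + t *: (w - z)).
Proof.
move=> [tz cz] [tw ow] t0 t1; split; first exact: triangle_conv.
by move=> n hn on; apply: ccell_conv => //; [exact: cz|exact: ow].
Qed.

Lemma region_cregion y : region y `<=` cregion y.
Proof. by move=> z [tz yz]; split=> // n hn /(yz _ hn)/ocellW. Qed.

End Layers.

(** * Faces as closures of convex regions *)

Section Faces.
Variables (R : realType) (N : nat).
Local Notation point := 'rV[R]_3.
Implicit Types (n : 'I_3 -> nat) (p q s y z w : point) (j k m : 'I_3).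

Definition close (e : R) s z := forall j, `|z 0 j - s 0 j| < e.

Lemma close_nbhs e s : 0 < e -> nbhs s (close e s).
Proof.
move=> e0; apply/nbhs_ballP; exists e => //= z [_ sz] j.
by have := sz 0 j; rewrite /ball /= distrC.
Qed.

Lemma nbhs_close s (B : set point) : nbhs s B ->
  exists2 e, 0 < e & forall z, close e s z -> B z.
Proof.
move=> /nbhs_ballP[e /= e0 eB]; exists e => // z sz; apply: eB; split => // i j.
by rewrite ord1 /ball /= distrC.
Qed.

Lemma triangle_le p j : triangle N p -> p 0 j <= N%:R.
Proof.
move=> [p0 ps]; have [k [m /and3P[km kj mj]]] := ord3_others j.
have jk : j != k by rewrite eq_sym.
have jm : j != m by rewrite eq_sym.
by have := ps; rewrite (sum_ord3 _ jk jm km); have := p0 k; have := p0 m; lra.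
Qed.

Lemma close_step e s y : 0 < e -> triangle N s -> triangle N y ->
  exists2 t0 : R, 0 < t0 <= 1 &
    forall t, 0 <= t <= t0 -> close e s (s + t *: (y - s)).
Proof.
(* Coordinates in the triangle differ by at most N, so a step t moves s by at most t N. *)
move=> e0 ts ty; have N0 := ler0n R N; exists (e / (e + N%:R + 1)).
  rewrite divr_gt0 //=; last by lra.
  by rewrite ler_pdivrMr ?mul1r; lra.
have d0 : 0 < e + N%:R + 1 by lra.
move=> t /andP[t0]; rewrite ler_pdivlMr // => te j.
rewrite !mxE addrAC subrr add0r normrM ger0_norm //.
have : `|y 0 j - s 0 j| <= N%:R.
  have := triangle_le j ts; have := triangle_le j ty.
  by have := ts.1 j; have := ty.1 j; rewrite ler_norml; lra.
by move=> /(ler_wpM2l t0); nra.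
Qed.

Lemma open_ocell n s : ocell n s ->
  exists2 e, 0 < e & forall z, close e s z -> ocell n z.
Proof.
move=> on; apply: nbhs_close; have Fs : Filter (nbhs s) := nbhs_filter s.
apply: (@filter_forall _ _ (fun j (z : point) => forall k, j != k ->
  (0 < n k)%N -> z 0 j - z 0 k < (n j)%:R - (n k)%:R + 1) (nbhs s) Fs) => j.
apply: (@filter_forall _ _ (fun k (z : point) => j != k ->
  (0 < n k)%N -> z 0 j - z 0 k < (n j)%:R - (n k)%:R + 1) (nbhs s) Fs) => k.
have [/andP[jk nk]|h] := boolP ((j != k) && (0 < n k)%N); last first.
  by apply: nearW => z jk nk; rewrite jk nk in h.
pose e := ((n j)%:R - (n k)%:R + 1 - (s 0 j - s 0 k)) / 2.
have e0 : 0 < e by have := on _ _ jk nk; rewrite /e; lra.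
apply: filterS (close_nbhs s e0) => z ze _ _.
by have := ze j; have := ze k; rewrite !ltr_distl /e; lra.
Qed.

Lemma closure_close (A : set point) s e : closure A s -> 0 < e ->
  exists2 z, A z & close e s z.
Proof. by move=> cA e0; have [z [Az ze]] := cA _ (close_nbhs s e0); exists z. Qed.

Lemma closure_ccell n : closure (ccell n : set point) `<=` ccell n.
Proof.
move=> s cs j k jk nk; rewrite leNgt; apply/negP => lt.
pose e := ((s 0 j - s 0 k) - ((n j)%:R - (n k)%:R + 1)) / 2.
have e0 : 0 < e by rewrite /e; lra.
have [z cz ze] := closure_close cs e0.
have := cz j k jk nk; have := ze j; have := ze k.
by rewrite !ltr_distl /e; lra.
Qed.

Lemma closure_triangle : closure (triangle N : set point) `<=` triangle N.
Proof.
move=> s cs; split=> [j|].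
  rewrite leNgt; apply/negP => lt.
  have e0 : 0 < - s 0 j by lra.
  have [z [z0 _] ze] := closure_close cs e0.
  by have := z0 j; have := ze j; rewrite ltr_distl; lra.
apply/eqP; rewrite -subr_eq0; apply: contrapT => /negP; rewrite -normr_gt0 => h.
have e0 : 0 < `|\sum_j s 0 j - (N%:R - 1)| / 3 by lra.
have [z [_ zs] ze] := closure_close cs e0.
move: (ze 0) (ze 1) (ze 2%:R) zs; set x := `|_ - (_ - 1)|.
rewrite !ltr_distl => z0 z1 z2 zs.
have xlt : x < x; last by rewrite ltxx in xlt.
move: zs; rewrite {1}/x.
rewrite !(@sum_ord3 _ _ 0 1 2%:R) // => zs.
by rewrite ltr_norml; lra.
Qed.

Lemma connected_segment p q : connected (segment p q : set point).
Proof.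
have -> : segment p q = (fun t : R => p + t *: (q - p)) @` `[0, 1].
  by apply/seteqP; split=> _ [t t01 <-]; exists t; rewrite //= in_itv in t01 *.
apply: connected_continuous_connected; first exact: segment_connected.
apply: continuous_subspaceT => t; apply: (@cvgD _ _ _ _ _ (fun=> p) (fun t : R => t *: (q - p))).
  exact: cvg_cst.
exact: (@scalel_continuous _ _ (q - p) t).
Qed.

Lemma region_component y : off N y ->
  connected_component (off N) y = region N y.
Proof.
move=> oy; have ty : triangle N y by case: oy.
apply/seteqP; split=> [z [C [Cy Coff Cc] Cz]|z yz].
  split; first by case: (Coff _ Cz).
  move=> n hn on.
  (* Off the graph the open and the closed cell cut out the same part of [C], which is therefore
     both open and closed in it. *)
  suff CE : C `&` ocell n = C by move: Cz; rewrite -{1}CE => -[].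
  have oc : C `&` ocell n = C `&` ccell n.
    apply/seteqP; split=> x [Cx xn]; split => //; first exact: ocellW.
    have [tx nx] := Coff _ Cx; have [n' dn' on'] := NgraphPn tx nx hn.
    by rewrite -(ocell_unique dn' on' xn).
  apply: Cc; first by exists y.
    exists (ocell n) => //; rewrite openE => x /open_ocell[e e0 h].
    exact: filterS h (close_nbhs x e0).
  by exists (ccell n) => //; exact: closure_ccell.
have segr : segment y z `<=` region N y.
  move=> _ [t /andP[t0 t1] <-].
  move: t0; rewrite le_eqVlt => /orP[/eqP <-|t0].
    by rewrite scale0r addr0; exact: region_refl.
  by apply: region_conv => //; exact/region_cregion/region_refl.
exists (segment y z); last first.
  by exists 1; rewrite /= ?lexx ?ler01 // scale1r addrC subrK.
split; last exact: connected_segment.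
  by exists 0; rewrite /= ?lexx ?ler01 // scale0r addr0.
by move=> x /segr; exact: off_region.
Qed.

Lemma closure_region y : off N y -> closure (region N y) = cregion N y.
Proof.
move=> oy; have ty : triangle N y by case: oy.
apply/seteqP; split=> s.
  move=> cs; split; first by apply: closure_triangle; apply: closure_subset cs => z [].
  move=> n hn on; apply: closure_ccell; apply: closure_subset cs => z [_ /(_ _ hn on)].
  exact: ocellW.
move=> cs B /nbhs_close[e e0 eB].
have [t /andP[t0 t1] te] := close_step e0 cs.1 ty.
exists (s + t *: (y - s)); split; last by apply/eB/te; rewrite (ltW t0) lexx.
by apply: region_conv => //; exact: region_refl.
Qed.

Lemma is_face_region y : off N y -> is_face N (cregion N y).
Proof. by move=> oy; exists y => //; rewrite region_component // closure_region. Qed.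

Definition face_of y (oy : off N y) : face R N := exist _ _ (is_face_region oy).

Lemma face_ofP (F : face R N) : exists y (oy : off N y), F = face_of oy.
Proof.
case: F => F fF; have [y oy FE] := fF; exists y, oy.
by apply: eq_exist; rewrite FE region_component // closure_region.
Qed.

Lemma face_of_eq y z (oy : off N y) (oz : off N z) :
  region N y z -> face_of oy = face_of oz.
Proof.
move=> yz; apply: eq_exist.
by rewrite -!closure_region // (region_eq oy yz).
Qed.

End Faces.

(** * Generic points and walls *)

Section Generic.
Variables (R : realType) (N : nat).
Local Notation point := 'rV[R]_3.
Implicit Types (n : 'I_3 -> nat) (p q s y z w : point) (j k m : 'I_3).

(** Just to the right of l, an increasing affine function stays strictly between two consecutive
    integers; a change of sign handles decreasing ones. *)
Lemma avoid_int1 (a b l u : R) : b != 0 \/ a \isn't a Num.int -> l < u ->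
  exists2 u', l < u' <= u & forall t, l < t < u' -> a + b * t \isn't a Num.int.
Proof.
suff pos a' b' : 0 < b' -> l < u ->
    exists2 u', l < u' <= u & forall t, l < t < u' -> a' + b' * t \isn't a Num.int.
  have [->|b0] := eqVneq b 0.
    case=> // ai lu; exists u; first by rewrite lu lexx.
    by move=> t _; rewrite mul0r addr0.
  move=> _ lu; case: (ltP 0 b) => [bp|]; first exact: pos.
  rewrite le_eqVlt (negPf b0) /= => bn.
  have [|u' hu' h] := pos (- a) (- b) _ lu; first by rewrite oppr_gt0.
  by exists u' => // t /h; rewrite mulNr -opprD rpredN.
move=> bp lu; set f := Num.floor (a' + b' * l).
have f0 : a' + b' * l < f%:~R + 1.
  by rewrite -intrD1; exact: floorD1_gt.
have c0 : 0 < (f%:~R + 1 - (a' + b' * l)) / b' by apply: divr_gt0 => //; lra.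
exists (Num.min u (l + (f%:~R + 1 - (a' + b' * l)) / b')).
  by rewrite lt_min lu ltrDl c0 ge_min lexx.
move=> t; rewrite lt_min => /and3P[lt _ tu]; apply/negP => /intrP[m e].
have : f%:~R < m%:~R :> R.
  rewrite -e; apply: (@le_lt_trans _ _ (a' + b' * l)); first exact: floor_le.
  by rewrite ltrD2l ltr_pM2l.
have : m%:~R < (f + 1)%:~R :> R.
  rewrite intrD -e; rewrite -ltrBlDl ltr_pdivlMr // in tu.
  by rewrite /=; nra.
rewrite !ltr_int; lia.
Qed.

Lemma avoid_int (I : eqType) (a b : I -> R) (l u : R) (r : seq I) :
  (forall i, b i != 0 \/ a i \isn't a Num.int) -> l < u ->
  exists2 t, l < t < u & forall x, x \in r -> a x + b x * t \isn't a Num.int.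
Proof.
move=> hab lu.
have [u' /andP[lu' u'u] h] : exists2 u', l < u' <= u & forall t, l < t < u' ->
    forall x, x \in r -> a x + b x * t \isn't a Num.int.
  elim: r => [|x r [u1 /andP[lu1 u1u] IH]]; first by exists u; rewrite ?lu ?lexx.
  have [u2 /andP[lu2 u21] h] := avoid_int1 (hab x) lu1.
  exists u2; first by rewrite lu2 (le_trans u21).
  move=> t /andP[lt tu] y; rewrite inE => /predU1P[->|]; first by apply: h; rewrite lt.
  by apply: IH; rewrite lt (lt_le_trans tu).
exists ((l + u') / 2); first by lra.
by apply: h; lra.
Qed.

(** The walls are the lines where a coordinate difference is an integer; every layer lies on
    them. *)
Definition offwalls z := forall j k, j != k -> z 0 j - z 0 k \isn't a Num.int.

Definition interior_pt z := forall j, 0 < z 0 j.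

Lemma cell_bound_int n j k : (n j)%:R - (n k)%:R + 1 =
  ((n j)%:Z - (n k)%:Z + 1)%:~R :> R.
Proof. by rewrite intrD intrB. Qed.

Lemma offwalls_off z : triangle N z -> offwalls z -> off N z.
Proof.
move=> tz oz; split=> // -[i hi /(layerP _ hi)[_ h]].
have [n dn cn] := ccell_exists (N - i) z.
have [|j [k [m [/and3P[jk _ _] nk e]]]] := ccell_boundary cn (h n _); first by lia.
by have := oz j k jk; rewrite e cell_bound_int intr_int.
Qed.

Lemma perturb p e : (2 <= N)%N -> triangle N p -> 0 < e ->
  exists z, [/\ close e p z, triangle N z, interior_pt z & offwalls z].
Proof.
move=> N2 tp e0.
have c0 : 1 <= N%:R - 1 :> R by rewrite lerBrDr -[1 + 1]/(2%:R) ler_nat.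
(* Three distinct numbers of sum 0: [q] stays in the plane of the triangle and [r] moves every
   coordinate difference. As (N-1)/3 >= 1/3, the bound 1/12 on [r] keeps [q] interior. *)
pose c (j : 'I_3) : R := if j == 0 then 1 else if j == 1 then 2 else -3.
have cI j k : c j = c k -> j = k.
  rewrite /c; case: j k => [[|[|[|]]] // ?] [[|[|[|]]] // ?] /=;
    by [move=> _; apply: val_inj | move=> h; exfalso; lra].
have cle j : -3 <= c j by rewrite /c; case: ifP => _; [|case: ifP => _]; lra.
pose I : eqType := ('I_3 * 'I_3)%type.
(* [r] is chosen so that no coordinate difference is constant on the segment from p to q. Diagonal
   pairs get the dummy slope 1. *)
have [|/=|r /andP[r0 r1] rP] := @avoid_int I (fun jk => p 0 jk.2 - p 0 jk.1)
  (fun jk => if jk.1 == jk.2 then 1 else c jk.1 - c jk.2) 0 (1/12) (enum {: I}).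
- move=> [j k] /=; left; case: (eqVneq j k) => [//|jk].
  by rewrite subr_eq0; apply/eqP => /cI/eqP; rewrite (negPf jk).
- lra.
pose q : point := \row_j ((N%:R - 1) / 3 + r * c j).
have iq : interior_pt q by move=> j; rewrite mxE; have := cle j; nra.
have tq : triangle N q.
  split=> [j|]; first exact/ltW/iq.
  by rewrite (@sum_ord3 _ _ 0 1 2%:R) // !mxE /c /=; lra.
have qp j k : j != k -> (q 0 j - q 0 k) - (p 0 j - p 0 k) != 0.
  move=> jk; have := rP (j, k); rewrite mem_enum /= (negPf jk) !mxE => /(_ isT).
  by apply: contraNneq => h; rewrite (_ : _ + _ = 0) //; lra.
have [t0 /andP[t00 t01] tc] := close_step e0 tp tq.
have [|//|t /andP[t1 t2] tP] := @avoid_int I (fun jk => p 0 jk.1 - p 0 jk.2)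
  (fun jk => if jk.1 == jk.2 then 1 else
     (q 0 jk.1 - q 0 jk.2) - (p 0 jk.1 - p 0 jk.2)) 0 t0 (enum {: I}).
  by move=> [j k] /=; left; case: (eqVneq j k) => [//|jk]; exact: qp.
exists (p + t *: (q - p)); split.
- by apply: tc; lra.
- by apply: triangle_conv => //; lra.
- by move=> j; rewrite !mxE; have := iq j; have := tp.1 j; rewrite !mxE; nra.
- move=> j k jk; have := tP (j, k); rewrite mem_enum /= (negPf jk) => /(_ isT).
  by congr (_ \isn't a _); rewrite [in RHS]mxE [in RHS]mxE; rewrite !mxE; ring.
Qed.

Lemma nonint_gap (r : R) : r \isn't a Num.int -> exists2 e, 0 < e &
  forall r' (M : int), `|r' - r| < e -> (r' < M%:~R) = (r < M%:~R).
Proof.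
move=> ri; set f := Num.floor r.
have f1 : r < f%:~R + 1 by rewrite -intrD1; exact: floorD1_gt.
have f0 : f%:~R < r.
  rewrite lt_neqAle floor_le andbT; apply: contraNneq ri => <-; exact: intr_int.
exists (Num.min (r - f%:~R) (f%:~R + 1 - r)); first by rewrite lt_min; lra.
move=> r' M; rewrite lt_min !ltr_distl => /andP[h1 h2].
have [Mf|fM] := leP M f.
  have : M%:~R <= f%:~R :> R by rewrite ler_int.
  by move=> ?; apply/idP/idP; lra.
have : (f + 1)%:~R <= M%:~R :> R by rewrite ler_int; lia.
by rewrite intrD => ?; apply/idP/idP => _; lra.
Qed.

Lemma int_gap (r : R) : exists2 e, 0 < e &
  forall r' (M : int), `|r' - r| < e -> r' < M%:~R -> r <= M%:~R.
Proof.
have [/intrP[m ->]|/nonint_gap[e e0 h]] := boolP (r \is a Num.int); last first.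
  by exists e => // r' M /h -> /ltW.
exists 1 => // r' M; rewrite ltr_distl => h1 h2; rewrite ler_int.
have : m%:~R - 1 < M%:~R :> R by lra.
rewrite -(intrB _ _ 1) ltr_int; lia.
Qed.

Lemma uniform_pos (P : 'I_3 -> 'I_3 -> R -> Prop) :
  (forall j k, exists2 e, 0 < e & forall e', e' <= e -> P j k e') ->
  exists2 e, 0 < e & forall j k, P j k e.
Proof.
move=> h.
have /choice[f fP] (x : 'I_3 * 'I_3) : exists e, 0 < e /\
    forall e', e' <= e -> P x.1 x.2 e'.
  by case: x => j k; have [e e0 eP] := h j k; exists e.
exists (\big[Num.min/1]_x f x).
  apply: (@big_ind _ (fun e : R => 0 < e)) => // [x y x0 y0|x _]; first by rewrite lt_min x0.
  by case: (fP x).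
move=> j k; apply: (fP (j, k)).2; rewrite (bigD1 (j, k)) //=.
by rewrite ge_min lexx.
Qed.

End Generic.

(** * Regions near a point on at most one wall *)

Section Walls.
Variables (R : realType) (N : nat).
Local Notation point := 'rV[R]_3.
Implicit Types (n : 'I_3 -> nat) (p q s y z w : point) (j k m : 'I_3).

Lemma region_open y : off N y -> exists2 e, 0 < e &
  forall z, triangle N z -> close e y z -> region N y z.
Proof.
move=> [ty ny].
(* A radius is needed for only one cell per level; the duplicated bound [deg n < N] carries the
   induction on the levels. *)
have [e e0 h] : exists2 e, 0 < e & forall z, triangle N z -> close e y z ->
    forall n, (0 < deg n < N)%N -> (deg n < N)%N -> ocell n y -> ocell n z.
  elim: {3}N => [|D [e e0 IH]]; first by exists 1.
  have [hD|hD] := boolP (0 < D < N)%N; last first.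
    exists e => // z tz yz n hn; rewrite ltnS leq_eqVlt => /orP[/eqP E|].
      by rewrite -E hn in hD.
    exact: IH.
  have [n dn on] := NgraphPn ty ny hD.
  have [e' e'0 h] := open_ocell on.
  exists (Num.min e e'); first by rewrite lt_min e0.
  move=> z tz yz n' hn'; rewrite ltnS leq_eqVlt => /orP[/eqP E|lt] on'.
    rewrite -(ocell_unique _ on (ocellW on')); last by rewrite dn E.
    by apply: h => j; have := yz j; rewrite lt_min => /andP[].
  by apply: IH => // j; have := yz j; rewrite lt_min => /andP[].
exists e => // z tz yz; split => // n hn; apply: h => //.
by case/andP: hn.
Qed.

Lemma close_conv e s y z (t : R) : 0 <= t -> t <= 1 -> close e s y ->
  close e s z -> close e s (y + t *: (z - y)).
Proof.
move=> t0 t1 sy sz j; have := sy j; have := sz j.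
rewrite !mxE !ltr_distl => /andP[h1 h2] /andP[h3 h4]; by case: (leP (y 0 j) (z 0 j)) => h; apply/andP; split; nra.
Qed.

Lemma region_refine y e : (2 <= N)%N -> off N y -> 0 < e -> exists z,
  [/\ region N y z, close e y z, interior_pt z & offwalls z].
Proof.
move=> N2 oy e0; have [e' e'0 h] := region_open oy.
have [|z [yz tz iz wz]] := @perturb R N y (Num.min e e') N2 oy.1.
  by rewrite lt_min e0.
exists z; split => //.
  by apply: h => // j; have := yz j; rewrite lt_min => /andP[].
by move=> j; have := yz j; rewrite lt_min => /andP[].
Qed.

(** Near s, an integer bound on a coordinate difference can be lost only if that difference is
    integral at s, and even then it holds weakly at s itself. *)
Lemma wall_gap s : exists2 g, 0 < g & forall (p q : 'I_3) (r' : R) (M : int),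
  `|r' - (s 0 p - s 0 q)| < g -> r' < M%:~R -> s 0 p - s 0 q <= M%:~R /\
  (s 0 p - s 0 q \isn't a Num.int -> forall r'', `|r'' - (s 0 p - s 0 q)| < g ->
   r'' < M%:~R).
Proof.
apply: (@uniform_pos _ (fun (p q : 'I_3) g => forall (r' : R) (M : int),
  `|r' - (s 0 p - s 0 q)| < g -> r' < M%:~R -> s 0 p - s 0 q <= M%:~R /\
  (s 0 p - s 0 q \isn't a Num.int -> forall r'', `|r'' - (s 0 p - s 0 q)| < g ->
   r'' < M%:~R))) => p q.
have [g1 g10 h1] := int_gap (s 0 p - s 0 q).
have [si|si] := boolP (s 0 p - s 0 q \is a Num.int).
  exists g1 => // e' e'g r' M re rM; split => //.
  by apply: h1 rM; apply: lt_le_trans re e'g.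
have [g2 g20 h2] := nonint_gap si.
exists (Num.min g1 g2); first by rewrite lt_min g10.
move=> e'; rewrite le_min => /andP[e1 e2] r' M re rM; split.
  by apply: h1 rM; apply: lt_le_trans re e1.
move=> _ r'' re'; rewrite h2 ?(lt_le_trans re') //.
by rewrite -(h2 r') // (lt_le_trans re).
Qed.

(* Near s only the wall "j-th minus k-th coordinate" can separate regions, so a
   short piece of it lies in the closure of every region close to s. *)
Lemma wall_segment s j k m e : triangle N s -> interior_pt s ->
  j != k -> j != m -> k != m -> s 0 j - s 0 m \isn't a Num.int ->
  s 0 k - s 0 m \isn't a Num.int -> 0 < e ->
  exists e' a b, [/\ 0 < e', a <> b, close e s a /\ close e s b &
    forall z, off N z -> close e' s z -> cregion N z a /\ cregion N z b].
Proof.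
move=> ts is_ jk jm km sjm skm e0.
have [g g0 gP] := wall_gap s.
pose d := Num.min (Num.min e g) (Num.min (s 0 j) (Num.min (s 0 k) (s 0 m))) / 4.
have [d0 de dg [dj dk dm]] : [/\ 0 < d, 4 * d <= e, 4 * d <= g &
    [/\ 4 * d <= s 0 j, 4 * d <= s 0 k & 4 * d <= s 0 m]].
  have -> : 4 * d = Num.min (Num.min e g) (Num.min (s 0 j) (Num.min (s 0 k) (s 0 m))).
    by rewrite /d; field.
  rewrite divr_gt0 ?lt_min ?e0 ?g0 ?is_ //.
  by rewrite !ge_min !lexx ?orbT.
(* The direction (1, 1, -2) keeps the difference of j and k, the only one that may be integral at s.
   The others move by 3 c, which stays below 4 d <= g. *)
pose v (c : R) : point := \row_l (s 0 l + c * (1 - 3 * (l == m)%:R)).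
have vj c : v c 0 j = s 0 j + c by rewrite mxE (negPf jm) mulr0n; ring.
have vk c : v c 0 k = s 0 k + c by rewrite mxE (negPf km) mulr0n; ring.
have vm c : v c 0 m = s 0 m - 2 * c by rewrite mxE eqxx mulr1n; ring.
have vclose c e1 : `|c| <= d -> 4 * d <= e1 -> close e1 s (v c).
  rewrite ler_norml => /andP[c1 c2] de1 l; rewrite ltr_distl.
  by have [->|->|->] := ord3_cases l jk jm km; rewrite ?vj ?vk ?vm; lra.
have vt c : `|c| <= d -> triangle N (v c).
  rewrite ler_norml => /andP[c1 c2]; split=> [l|].
    by have [->|->|->] := ord3_cases l jk jm km; rewrite ?vj ?vk ?vm; lra.
  rewrite (sum_ord3 _ jk jm km) vj vk vm; have := ts.2.
  by rewrite (sum_ord3 _ jk jm km); lra.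
have vc c z : `|c| <= d -> off N z -> close (g / 2) s z -> cregion N z (v c).
  move=> cd oz sz; split; first exact: vt.
  move=> n hn on p q pq nq; have := on p q pq nq; rewrite cell_bound_int => zM.
  have zg : `|(z 0 p - z 0 q) - (s 0 p - s 0 q)| < g.
    by have := sz p; have := sz q; rewrite !ltr_distl; lra.
  have [sM sM'] := gP p q _ _ zg zM.
  have [si|si] := boolP (s 0 p - s 0 q \is a Num.int); last first.
    apply/ltW/sM' => //; move: cd; rewrite ler_norml => /andP[c1 c2].
    rewrite ltr_distl.
    by have [->|->|->] := ord3_cases p jk jm km;
       have [->|->|->] := ord3_cases q jk jm km; rewrite ?vj ?vk ?vm; lra.
  suff -> : v c 0 p - v c 0 q = s 0 p - s 0 q by [].
  have sij i : i != m -> s 0 i - s 0 m \isn't a Num.int.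
    by have [->|->|->] := ord3_cases i jk jm km; rewrite ?eqxx.
  have [pm|pm] := eqVneq p m.
    rewrite pm in si pq; rewrite eq_sym in pq.
    by have := sij _ pq; rewrite -rpredN opprB si.
  have [qm|qm] := eqVneq q m.
    by have := sij _ pm; rewrite -qm si.
  by rewrite !mxE (negPf pm) (negPf qm) mulr0n; lra.
exists (g / 2), (v d), (v (- d)); split.
- lra.
- by move=> /(congr1 (fun f : point => f 0 j)); rewrite !vj; lra.
- by split; apply: vclose => //; rewrite ?normrN ger0_norm ?(ltW d0).
- by move=> z oz sz; split; apply: vc => //; rewrite ?normrN ger0_norm ?(ltW d0).
Qed.

End Walls.

(** * Faces in a common cell *)

Section Paths.
Variables (R : realType) (N : nat).
Local Notation point := 'rV[R]_3.
Implicit Types (n : 'I_3 -> nat) (p q s y z w : point) (j k m : 'I_3).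

(** [Q t d] reads: d is a value at time t of a function defined only on a dense set of times. The
    set [B] of times near which all values are c0 is open and closed in [0,1]. *)
Lemma chain (X : Type) (Q : R -> X -> Prop) (c0 c1 : X) :
  (forall t, 0 <= t <= 1 -> exists2 e, 0 < e & forall t1 t2 d1 d2,
     0 <= t1 <= 1 -> 0 <= t2 <= 1 -> `|t1 - t| < e -> `|t2 - t| < e ->
     Q t1 d1 -> Q t2 d2 -> d1 = d2) ->
  (forall t e, 0 <= t <= 1 -> 0 < e ->
     exists t1 d, [/\ 0 <= t1 <= 1, `|t1 - t| < e & Q t1 d]) ->
  Q 0 c0 -> Q 1 c1 -> c0 = c1.
Proof.
move=> loc dense Q0 Q1.
pose B (t : R) := exists2 e, 0 < e & forall t1 d, 0 <= t1 <= 1 ->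
  `|t1 - t| < e -> Q t1 d -> d = c0.
have B0 : B 0.
  have [|e e0 h] := loc 0; first by rewrite lexx ler01.
  exists e => // t1 d t01 te Qd; apply: h Qd Q0 => //; rewrite ?lexx ?ler01 //.
  by rewrite subrr normr0.
suff /(_ 1) : `[0, 1]%classic `<=` (`[0, 1] `&` B)%classic.
  rewrite /= in_itv /= ler01 lexx => -[//|_ [e e0 h]].
  by apply/esym/(h 1) => //; rewrite ?ler01 ?lexx // subrr normr0.
suff -> : (`[0, 1] `&` B)%classic = `[0, 1]%classic by [].
apply: segment_connected.
- by exists 0; split => //=; rewrite in_itv /= lexx ler01.
- exists B => //; rewrite openE => t [e e0 h].
  apply/nbhs_ballP; exists (e / 2) => /=; first lra.
  move=> t' tt'; exists (e / 2); first lra.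
  move=> t1 d t01 tt1; apply: h => //.
  move: tt' tt1; rewrite /ball /= !ltr_distl; lra.
exists (closure (`[0, 1] `&` B)%classic); first exact: closed_closure.
apply/seteqP; split=> t [t01 Bt]; split => //; first exact: subset_closure.
have t01' : 0 <= t <= 1 by move: t01; rewrite /= in_itv.
have [e e0 h] := loc t t01'.
have e20 : 0 < e / 2 by lra.
have [t1 [[t101 [e1 e10 h1]] tt1]] := Bt _ (nbhsx_ballx t (e / 2) e20).
have t101' : 0 <= t1 <= 1 by move: t101; rewrite /= in_itv.
have [|t2 [d [t201 t21 Qd]]] := dense t1 (Num.min (e / 2) e1) t101'.
  by rewrite lt_min e20.
move: t21; rewrite lt_min => /andP[t21 t21'].
have dc := h1 _ _ t201 t21' Qd.
exists e => // t3 d3 t301 t3e Qd3; rewrite -dc.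
apply: h Qd3 Qd => //.
by move: tt1 t21; rewrite /ball /= !ltr_distl; lra.
Qed.

Section Constancy.
Variables (X : Type) (phi : face R N -> X) (i : nat) (n : 'I_3 -> nat).
Hypotheses (hi : (0 < i < N)%N) (dn : (deg n + i)%N = N).
Hypothesis phi_eq : forall F1 F2 a b, share_segment F1 F2 a b ->
  segment a b `&` layer N i = set0 -> phi F1 = phi F2.

(** All faces close to s contain a common segment along the only possible wall through s, and inside
    the cell n that segment avoids layer i. *)
Lemma phi_local s j k m : triangle N s -> interior_pt s -> ocell n s ->
  j != k -> j != m -> k != m -> s 0 j - s 0 m \isn't a Num.int ->
  s 0 k - s 0 m \isn't a Num.int ->
  exists2 e, 0 < e & forall z z' (oz : off N z) (oz' : off N z'),
    close e s z -> close e s z' -> phi (face_of oz) = phi (face_of oz').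
Proof.
move=> ts is_ on jk jm km sjm skm.
have [e0 e00 e0P] := open_ocell on.
have [e [a [b [e_0 ab [sa sb] h]]]] :=
  wall_segment ts is_ jk jm km sjm skm e00.
exists e => // z z' oz oz' sz sz'.
have [->//|FF'] := pselect (face_of oz = face_of oz').
have [za zb] := h z oz sz; have [z'a z'b] := h z' oz' sz'.
apply: (@phi_eq _ _ a b).
  by split => // _ [t /andP[t0 t1] <-]; split; apply: cregion_conv.
apply/seteqP; split=> // _ [[t /andP[t0 t1] <-]] /(layerP _ hi)[_ /(_ n dn)].
by apply; apply: e0P; apply: close_conv.
Qed.

Lemma diff_le p j k : triangle N p -> `|p 0 j - p 0 k| <= N%:R.
Proof.
move=> tp; have := triangle_le j tp; have := triangle_le k tp.
by have := tp.1 j; have := tp.1 k; rewrite ler_norml; lra.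
Qed.

Lemma int_range (r : R) : r \is a Num.int -> `|r| <= N%:R ->
  exists2 l, l \in iota 0 (2 * N).+1 & r = l%:R - N%:R.
Proof.
move=> /intrP[M ->]; rewrite ler_norml => /andP[h1 h2].
have : (- (N%:Z) <= M)%R by rewrite -(ler_int R) mulrNz.
have : (M <= N%:Z)%R by rewrite -(ler_int R).
move=> h3 h4; exists (absz (M + N%:Z)); first by rewrite mem_iota; lia.
rewrite -[(absz _)%:R]/((Posz _)%:~R) gez0_abs; last by lia.
by rewrite intrD addrK.
Qed.

Lemma nonint_chain (x y z : R) : x - y \is a Num.int ->
  y - z \isn't a Num.int -> x - z \isn't a Num.int.
Proof.
move=> xy; apply: contraNN => xz.
have -> : y - z = (x - z) - (x - y) by ring.
by rewrite rpredB.
Qed.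

Lemma lineE p q (t : R) l :
  (p + t *: (q - p)) 0 l = p 0 l + t * (q 0 l - p 0 l).
Proof. by rewrite !mxE. Qed.

(* Move y1 inside its face until the segment from y2 to y1 avoids every point lying
   on two walls; l enumerates the integers which the first wall function can take
   on the segment. *)
Lemma phi_const_generic y1 y2 (o1 : off N y1) (o2 : off N y2) :
  interior_pt y1 -> interior_pt y2 -> offwalls y2 ->
  ocell n y1 -> ocell n y2 -> phi (face_of o1) = phi (face_of o2).
Proof.
move=> i1 i2 w2 on1 on2.
have [e e0 eP] := region_open o1.
pose du := (y1 0 0 - y1 0 1) - (y2 0 0 - y2 0 1).
(* [c l] is the time at which the difference of coordinates 0 and 1 equals l - N. Moving y1 by r in
   the direction (1, 1, -2) leaves [c l] fixed and changes the difference of coordinates 1 and 2 at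
   that time by 3 r times [c l]. *)
pose c (l : nat) : R := (l%:R - N%:R - (y2 0 0 - y2 0 1)) / du.
pose B := y2 0 1 - y2 0 2%:R.
pose A := y1 0 1 - y1 0 2%:R.
have [l|/=|r /andP[r0 r1] rP] := @avoid_int R nat (fun l => B + c l * (A - B))
  (fun l => 3 * c l) 0 (Num.min e (y1 0 2%:R) / 4) (iota 0 (2 * N).+1).
(* For [du = 0] the convention on the inverse of 0 gives [c l = 0], and the value to avoid integers
   is that at y2. *)
- have [d0|d0] := eqVneq du 0.
    by right; rewrite /c d0 invr0 mulr0 mul0r addr0; apply: w2.
  left; rewrite mulf_neq0 // mulf_neq0 ?invr_eq0 // subr_eq0 eq_sym.
  apply: contraNneq (w2 0 1 isT) => ->.
  by rewrite rpredB // natr_int.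
- by rewrite divr_gt0 // lt_min e0 i1.
have {r1} [re r2] : 4 * r < e /\ 4 * r < y1 0 2%:R.
  by move: r1; rewrite ltr_pdivlMr // mulrC lt_min => /andP[].
pose w : point := \row_l (y1 0 l + r * (1 - 3 * (l == 2%:R)%:R)).
have w0 : w 0 0 = y1 0 0 + r by rewrite mxE mulr0n; ring.
have w1 : w 0 1 = y1 0 1 + r by rewrite mxE mulr0n; ring.
have w2' : w 0 2%:R = y1 0 2%:R - 2 * r by rewrite mxE eqxx mulr1n; ring.
have iw : interior_pt w.
  move=> l; have := i1 0; have := i1 1.
  by have [->|->|->] := @ord3_cases 0 1 2%:R l isT isT isT; rewrite ?w0 ?w1 ?w2'; lra.
have tw : triangle N w.
  split=> [l|]; first exact/ltW/iw.
  have := o1.1.2; rewrite !(@sum_ord3 _ _ 0 1 2%:R) // w0 w1 w2'; lra.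
have yw : region N y1 w.
  apply: eP => // l; rewrite ltr_distl.
  by have [->|->|->] := @ord3_cases 0 1 2%:R l isT isT isT; rewrite ?w0 ?w1 ?w2'; lra.
have ow := off_region o1 yw.
have onw : ocell n w by apply: yw.2 => //; lia.
rewrite (face_of_eq o1 ow yw).
pose p t := y2 + t *: (w - y2).
have tp t : 0 <= t <= 1 -> triangle N (p t).
  by move=> /andP[t0 t1]; exact: triangle_conv o2.1 tw.
have ip t : 0 <= t <= 1 -> interior_pt (p t).
  by move=> /andP[t0 t1] l; rewrite lineE; have := iw l; have := i2 l;
    case: (leP (w 0 l) (y2 0 l)) => h; nra.
have op t : 0 <= t <= 1 -> ocell n (p t).
  move=> /andP[t0 t1]; move: t0; rewrite le_eqVlt => /orP[/eqP <-|t0].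
    by rewrite /p scale0r addr0.
  by apply: ocell_conv => //; exact: ocellW.
have pc t t' e1 : 0 < e1 -> `|t' - t| < e1 / (N%:R + 1) -> close e1 (p t) (p t').
  move=> e10 tt' l; rewrite !lineE opprD addrACA subrr add0r -mulrBl normrM.
  have N0 := ler0n R N.
  move: tt'; rewrite ltr_pdivlMr; last by lra.
  have : `|w 0 l - y2 0 l| <= N%:R.
    have := triangle_le l tw; have := triangle_le l o2.1.
    by have := tw.1 l; have := o2.1.1 l; rewrite ler_norml; lra.
  by have := normr_ge0 (t' - t); nra.
have N1 : 0 < N%:R + 1 :> R by have := ler0n R N; lra.
pose Q t d := exists oz : off N (p t), phi (face_of oz) = d.
have Q0 : Q 0 (phi (face_of o2)).
  by rewrite /Q /p scale0r addr0; exists o2.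
have Q1 : Q 1 (phi (face_of ow)).
  by rewrite /Q /p scale1r addrC subrK; exists ow.
apply/esym; apply: (chain (Q := Q)) Q0 Q1 => [t t01|t e1 t01 e10].
  have [e1 e10 h] : exists2 e1, 0 < e1 & forall z z' (oz : off N z) (oz' : off N z'),
      close e1 (p t) z -> close e1 (p t) z' -> phi (face_of oz) = phi (face_of oz').
    have tpt := tp t t01; have ipt := ip t t01; have opt := op t t01.
    (* In each of the three cases, the first two indices given to [phi_local] are the only pair
       whose difference may be integral. *)
    have [u|u] := boolP (p t 0 0 - p t 0 1 \is a Num.int).
      have v : p t 0 1 - p t 0 2%:R \isn't a Num.int.
        have [l li lE] := int_range u (diff_le _ _ (tp t t01)).
        have := rP l li; congr (_ \isn't a _).
        have uE : p t 0 0 - p t 0 1 = y2 0 0 - y2 0 1 + t * du.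
          by rewrite !lineE w0 w1 /du; ring.
        have du0 : du != 0.
          apply: contraTneq u => d0; rewrite uE d0 mulr0 addr0; exact: w2.
        have ct : c l = t.
          by rewrite /c -lE uE addrAC subrr add0r mulfK.
        by rewrite ct /A /B !lineE w1 w2'; ring.
      apply: (@phi_local (p t) 0 1 2%:R) => //.
      exact: nonint_chain u v.
    have [v|v] := boolP (p t 0 1 - p t 0 2%:R \is a Num.int).
      have u' : p t 0 1 - p t 0 0 \isn't a Num.int by rewrite -rpredN opprB.
      apply: (@phi_local (p t) 1 2%:R 0) => //.
      by apply: nonint_chain u'; rewrite -rpredN opprB.
    apply: (@phi_local (p t) 0 2%:R 1) => //.
    by rewrite -rpredN opprB.
  have e1N : 0 < e1 / (N%:R + 1) by exact: divr_gt0.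
  exists (e1 / (N%:R + 1)) => // t1 t2 d1 d2 t101 t201 t1t t2t [oz <-] [oz' <-].
  by apply: h; exact: pc.
pose I : eqType := ('I_3 * 'I_3)%type.
pose sl (jk : I) : R := if jk.1 == jk.2 then 1 else
  (w 0 jk.1 - w 0 jk.2) - (y2 0 jk.1 - y2 0 jk.2).
have [[j k] /=||t1 /andP[t11 t12] tP] := @avoid_int R I
  (fun jk => y2 0 jk.1 - y2 0 jk.2) sl (Num.max 0 (t - e1)) (Num.min 1 (t + e1))
  (enum {: I}).
- rewrite /sl /=; case: (eqVneq j k) => [_|jk]; first by left.
  by right; exact: w2.
- by rewrite gt_max !lt_min; lra.
move: t11 t12; rewrite gt_max lt_min => /andP[t1a t1b] /andP[t1c t1d].
have t101 : 0 <= t1 <= 1 by lra.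
have ot : off N (p t1).
  apply: offwalls_off; first exact: tp.
  move=> j k jk; have := tP (j, k); rewrite mem_enum /sl /= (negPf jk) => /(_ isT).
  by congr (_ \isn't a _); rewrite !lineE; ring.
exists t1, (phi (face_of ot)); split => //; last by exists ot.
by rewrite ltr_distl; lra.
Qed.

Lemma phi_const y1 y2 (o1 : off N y1) (o2 : off N y2) :
  ocell n y1 -> ocell n y2 -> phi (face_of o1) = phi (face_of o2).
Proof.
move=> on1 on2; have N2 : (2 <= N)%N by lia.
have [z1 [yz1 _ i1 w1]] := region_refine N2 o1 ltr01.
have [z2 [yz2 _ i2 w2]] := region_refine N2 o2 ltr01.
have oz1 := off_region o1 yz1; have oz2 := off_region o2 yz2.
rewrite (face_of_eq o1 oz1 yz1) (face_of_eq o2 oz2 yz2).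
apply: phi_const_generic => //; first by apply: yz1.2 => //; lia.
by apply: yz2.2 => //; lia.
Qed.

End Constancy.
End Paths.

(** * Cells of two faces sharing a segment *)

Section Adjacency.
Variables (R : realType) (N : nat).
Local Notation point := 'rV[R]_3.
Implicit Types (n : 'I_3 -> nat) (s y z w : point) (j k m : 'I_3).

(** One point of the segment suffices: it has an open cell at this level, and uniqueness forces the
    cells of both faces to be that one. *)
Lemma share_off_layer i y1 y2 (o1 : off N y1) (o2 : off N y2) a b :
  (0 < i < N)%N -> share_segment (face_of o1) (face_of o2) a b ->
  segment a b `&` layer N i = set0 ->
  exists n, [/\ (deg n + i)%N = N, ocell n y1 & ocell n y2].
Proof.
move=> hi [_ _ sub] dis.
have sa : segment a b a by exists 0; rewrite /= ?lexx ?ler01 // scale0r addr0.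
have [[ta c1] [_ c2]] := sub a sa.
have hd : (0 < N - i < N)%N by lia.
have [n dn on] : exists2 n, deg n = (N - i)%N & ocell n a.
  apply: contrapT => h; suff : (segment a b `&` layer N i) a by rewrite dis.
  split=> //; apply/layerP => //; split=> // n dn on; apply: h; exists n => //; lia.
have [n1 dn1 on1] := NgraphPn o1.1 o1.2 hd.
have [n2 dn2 on2] := NgraphPn o2.1 o2.2 hd.
exists n; split; first by lia.
  rewrite (@ocell_unique _ n n1 a) ?dn ?dn1 //; apply: c1 => //; lia.
rewrite (@ocell_unique _ n n2 a) ?dn ?dn2 //; apply: c2 => //; lia.
Qed.

(** A generic point s of the segment lies on a single wall, which bounds the common cell n. Both
    faces are on the inner side of it, so they would coincide near s. *)
Lemma share_layer i n y1 y2 (o1 : off N y1) (o2 : off N y2) a b :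
  (0 < i < N)%N -> (deg n + i)%N = N -> ocell n y1 -> ocell n y2 ->
  share_segment (face_of o1) (face_of o2) a b ->
  ~ segment a b `<=` layer N i.
Proof.
move=> hi dn on1 on2 [F12 ab sub] lay.
have in_seg t : 0 <= t <= 1 -> segment a b (a + t *: (b - a)) by exists t.
have ta : triangle N a.
  have [|[]//] := sub a _; rewrite -[X in segment _ _ X]addr0 -(scale0r (b - a)).
  by apply: in_seg; rewrite lexx ler01.
have tb : triangle N b.
  have [|[]//] := sub b _; rewrite -[X in segment _ _ X](subrK a) addrC -(scale1r (b - a)).
  by apply: in_seg; rewrite lexx ler01.
pose I : eqType := ('I_3 * 'I_3)%type.
pose sl (jk : I) : R := (b 0 jk.1 - b 0 jk.2) - (a 0 jk.1 - a 0 jk.2).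
(* Differences constant along the segment are replaced by the nonintegral dummy 1/2; the others
   become nonintegral at [t]. *)
have [[j k] /=||t /andP[t0 t1] tP] := @avoid_int R I
  (fun jk => if sl jk == 0 then 2^-1 else a 0 jk.1 - a 0 jk.2) sl 0 1 (enum {: I}).
- case: (eqVneq (sl (j, k)) 0) => _; last by left.
  right; apply/negP => /intrP[M hM].
  have : 0%:~R < M%:~R :> R by rewrite -hM; lra.
  have : M%:~R < 1%:~R :> R by rewrite -hM; lra.
  by rewrite !ltr_int; lia.
- exact: ltr01.
set s := a + t *: (b - a).
have ss : segment a b s by apply: in_seg; lra.
have [[ts c1] [_ c2]] := sub s ss.
have sE l : s 0 l = a 0 l + t * (b 0 l - a 0 l) by exact: lineE.
clearbody s.
have cn : ccell n s by apply: c1 => //; lia.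
have non : ~ ocell n s by case/(layerP _ hi): (lay s ss) => _; apply.
have [j [k [m [/and3P[jk jm km] nk sjk]]]] := ccell_boundary cn non.
have slE p q : s 0 p - s 0 q = a 0 p - a 0 q + sl (p, q) * t.
  by rewrite !sE /sl /=; ring.
have nonint p q : sl (p, q) != 0 -> s 0 p - s 0 q \isn't a Num.int.
  by move=> h; have := tP (p, q); rewrite mem_enum (negPf h) -slE; apply.
have djk : sl (j, k) = 0.
  by apply/eqP; apply: contraTT isT => /nonint; rewrite sjk cell_bound_int intr_int.
have sm (i' : 'I_3) : i' != m -> s 0 i' - s 0 m \isn't a Num.int.
  move=> im; apply/nonint/eqP => h; apply: ab.
  have {im h} hj : sl (j, m) = 0.
    have [E|E|E] := ord3_cases i' jk jm km; move: h djk im; rewrite E // /sl /=.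
      lra.
    by rewrite eqxx.
  have := tb.2; rewrite -ta.2 !(sum_ord3 _ jk jm km) => sab.
  move: hj djk; rewrite /sl /= => hj hk; apply/rowP => l.
  by have [->|->|->] := ord3_cases l jk jm km; lra.
have [g g0 gP] := wall_gap s.
(* The bound 1/2 serves the wall difference itself: within g' of s it is less than one unit away
   from its integral value at s. *)
pose g' := Num.min (g / 2) (2^-1).
have g'0 : 0 < g' by rewrite lt_min; lra.
have g'g : g' <= g / 2 by rewrite ge_min lexx.
have g'1 : g' <= 2^-1 by rewrite ge_min lexx orbT.
have near y (oy : off N y) : ocell n y -> cregion N y s -> exists z,
    [/\ region N y z, z 0 j - z 0 k < s 0 j - s 0 k & close g' s z].
  move=> ony cy; have [u /andP[u0 u1] uP] := close_step g'0 ts oy.1.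
  exists (s + u *: (y - s)); split; last by apply: uP; rewrite lexx ltW.
    by apply: region_conv => //; exact/region_refl/oy.1.
  by rewrite !lineE; have := ony j k jk nk; rewrite -sjk; nra.
have [z1 [yz1 l1 s1]] := near y1 o1 on1 (conj ts c1).
have [z2 [yz2 l2 s2]] := near y2 o2 on2 (conj ts c2).
have oz1 := off_region o1 yz1; have oz2 := off_region o2 yz2.
apply: F12; rewrite (face_of_eq o1 oz1 yz1) (face_of_eq o2 oz2 yz2).
apply: face_of_eq; split; first exact: oz2.1.
move=> n' hn' on' p q pq nq; have := on' p q pq nq; rewrite cell_bound_int => zM.
have cl z : close g' s z -> `|(z 0 p - z 0 q) - (s 0 p - s 0 q)| < g.
  by move=> sz; have := sz p; have := sz q; rewrite !ltr_distl; lra.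
have [sM sM'] := gP p q _ _ (cl _ s1) zM.
have [|si] := boolP (s 0 p - s 0 q \is a Num.int); last exact/sM'/cl.
have [pm|pm] := eqVneq p m.
  by rewrite pm -rpredN opprB (negPf (sm _ _)) // -pm eq_sym.
have [qm|qm _] := eqVneq q m; first by rewrite qm (negPf (sm _ _)).
have [pj|pj] : p = j \/ p = k.
  by have [->|->|E] := ord3_cases p jk jm km; [left|right|rewrite E eqxx in pm].
  have qk : q = k.
    have [E|->|E] := ord3_cases q jk jm km => //; first by rewrite E pj eqxx in pq.
    by rewrite E eqxx in qm.
  by rewrite pj qk in sM *; lra.
have qj : q = j.
  have [->|E|E] := ord3_cases q jk jm km => //; first by rewrite E pj eqxx in pq.
  by rewrite E eqxx in qm.
rewrite pj qj in zM *; set M := (_ - _ + 1) in zM *.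
have sMM : s 0 j - s 0 k = ((n j)%:Z - (n k)%:Z + 1)%:~R by rewrite -cell_bound_int.
set M0 := (_ - _ + 1) in sMM.
have : - M0 + 1 <= M by rewrite lezD1 -(ltr_int R) rmorphN /= -sMM; lra.
rewrite -(ler_int R) intrD rmorphN /= -sMM => ?.
by have := s2 j; have := s2 k; rewrite !ltr_distl; lra.
Qed.

End Adjacency.

(** * Faces with prescribed cells *)

Section Existence.
Variables (R : realType) (N : nat).
Hypothesis N2 : (2 <= N)%N.
Local Notation point := 'rV[R]_3.
Implicit Types (n : 'I_3 -> nat) (s y z w : point) (j k m : 'I_3).

Lemma ocell_node n (c : R) : ocell n (node n c).
Proof. by move=> j k jk nk; rewrite !mxE; lra. Qed.

(** Places the subspaces of n and n + e_j in the flag of one face. For i = 1 the larger exponent has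
    degree N, where no cell condition is imposed. *)
Lemma nested_point i n j : (0 < i)%N -> (deg n + i)%N = N ->
  exists y, [/\ off N y, ocell n y & (1 < i)%N -> ocell (incr n j) y].
Proof.
move=> i0 dn.
suff [p [tp on on']] : exists p : point,
    [/\ triangle N p, ocell n p & (1 < i)%N -> ocell (incr n j) p].
  have [e e0 eP] := open_ocell on.
  have [i1|i1] := boolP (1 < i)%N; last first.
    have [y [py ty _ wy]] := perturb N2 tp e0.
    by exists y; split; [exact: offwalls_off | exact: eP |].
  have [e' e'0 eP'] := open_ocell (on' i1).
  have [|y [py ty _ wy]] := @perturb R N p (Num.min e e') N2 tp.
    by rewrite lt_min e0.
  exists y; split; [exact: offwalls_off | apply: eP | move=> _; apply: eP'] => l;
    by have := py l; rewrite lt_min => /andP[].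
case: i => [//|[|i]] in i0 dn *.
  exists (node n (0%:R / 3)); split => //; last exact: ocell_node.
  by apply: triangle_node; rewrite addn0 -addn1.
pose v := node n (i.+1%:R / 3 : R).
pose v' := node (incr n j) (i%:R / 3 : R).
have tv : triangle N v by apply: triangle_node; rewrite -addnS.
have tv' : triangle N v' by apply: triangle_node; rewrite deg_incr -!addnS addSnnS.
have half : 0 < (2^-1 : R) by lra.
have half1 : (2^-1 : R) <= 1 by lra.
have b01 (a b : 'I_3) : (0 <= ((a == b)%:R : R)) && ((a == b)%:R <= (1 : R)).
  by rewrite ler0n lern1 leq_b1.
(* Each of the two nodes lies in its own open cell and in the closed cell of the other, so the
   midpoint lies in both open cells. *)
exists (v + 2^-1 *: (v' - v)); split.
- by apply: triangle_conv => //; exact: ltW.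
- have -> : v + 2^-1 *: (v' - v) = v' + 2^-1 *: (v - v').
    by apply/rowP => l; rewrite !lineE; lra.
  apply: ocell_conv => //; last exact: ocell_node.
  move=> a b ab nb; rewrite !mxE !natrD.
  by have := b01 a j; have := b01 b j; lra.
- move=> _; apply: ocell_conv => //; last exact: ocell_node.
  move=> a b ab nb; rewrite !mxE !natrD.
  by have := b01 a j; have := b01 b j; lra.
Qed.

Lemma adjacent_faces i n j k : (0 < i)%N -> (deg n + i).+1 = N -> j != k ->
  exists y1 y2 (o1 : off N y1) (o2 : off N y2) a b,
  [/\ ocell (incr n j) y1, ocell (incr n k) y2,
      share_segment (face_of o1) (face_of o2) a b & segment a b `<=` layer N i].
Proof.
move=> i0 dn jk; have [m /andP[jm km]] := ord3_third jk.
have hi : (0 < i < N)%N by rewrite i0 -dn ltnS leq_addl.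
(* On the edge separating the two cells, a quarter of [dir R m] away from its node: the differences
   with coordinate m are integers plus 1/4, so no other wall passes through s. *)
pose s := node n (i%:R / 3) + 4^-1 *: dir R m.
have i1 : 1 <= i%:R :> R by rewrite ler1n.
have sj : s 0 j = (n j)%:R + i%:R / 3 + 12^-1.
  by rewrite !mxE (negPf jm) mulr0n; lra.
have sk : s 0 k = (n k)%:R + i%:R / 3 + 12^-1.
  by rewrite !mxE (negPf km) mulr0n; lra.
have sm : s 0 m = (n m)%:R + i%:R / 3 - 6^-1.
  by rewrite !mxE eqxx mulr1n; lra.
have ck : ccell (incr n k) s by apply: ccell_edge => // _; lra.
have cj : ccell (incr n j) s by apply: ccell_edge => // _; lra.
have is_ : interior_pt s.
  move=> l; have := ler0n R (n j); have := ler0n R (n k); have := ler0n R (n m).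
  by have [->|->|->] := ord3_cases l jk jm km; rewrite ?sj ?sk ?sm; lra.
have ts : triangle N s.
  split=> [l|]; first exact/ltW/is_.
  rewrite (sum_ord3 _ jk jm km) sj sk sm -dn -(@natr1 R (deg n + i)) natrD.
  by rewrite (natr_deg _ _ jk jm km); lra.
have quarter (a b : nat) : a%:R - b%:R + 4^-1 \isn't a @Num.int R.
  rewrite -rpredN opprD; apply/negP => /intrP[M hM].
  have : (b%:Z - a%:Z - 1)%:~R < M%:~R :> R.
    by rewrite -hM !intrB /=; lra.
  have : M%:~R < (b%:Z - a%:Z)%:~R :> R by rewrite -hM !intrB /=; lra.
  by rewrite !ltr_int; lia.
have sjm : s 0 j - s 0 m \isn't a Num.int.
  rewrite (_ : _ - _ = (n j)%:R - (n m)%:R + 4^-1) ?quarter // sj sm; lra.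
have skm : s 0 k - s 0 m \isn't a Num.int.
  rewrite (_ : _ - _ = (n k)%:R - (n m)%:R + 4^-1) ?quarter // sk sm; lra.
clearbody s.
have [e [a [b [e0 ab _ h]]]] := wall_segment ts is_ jk jm km sjm skm ltr01.
have near l : ccell (incr n l) s ->
    exists y, [/\ off N y, ocell (incr n l) y & close e s y].
  move=> cl; have e20 : 0 < e / 2 by lra.
  have iE : i = i.-1.+1 by rewrite prednK.
  pose i' := i.-1; pose v := node (incr n l) (i'%:R / 3 : R).
  have tv : triangle N v.
    by apply: triangle_node; rewrite deg_incr addSnnS -iE.
  have [t /andP[t0 t1] tP] := close_step e20 ts tv.
  have ol : ocell (incr n l) (s + t *: (v - s)).
    by apply: ocell_conv => //; exact: ocell_node.
  have [e' e'0 eP] := open_ocell ol.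
  have [||y [py ty _ wy]] := @perturb R N (s + t *: (v - s)) (Num.min (e / 2) e') N2.
  - by apply: triangle_conv => //; exact: ltW.
  - by rewrite lt_min e20.
  exists y; split; first exact: offwalls_off.
    by apply: eP => x; have := py x; rewrite lt_min => /andP[].
  move=> x; have := py x; rewrite lt_min => /andP[p1 _].
  have st : 0 <= t <= t by rewrite lexx ltW.
  have := tP t st x; move: p1; rewrite !ltr_distl; lra.
have [y1 [f1 on1 s1]] := near j cj; have [y2 [f2 on2 s2]] := near k ck.
have [a1 b1] := h y1 f1 s1; have [a2 b2] := h y2 f2 s2.
have dj : (deg (incr n j) + i)%N = N by rewrite deg_incr addSn.
have dk : (deg (incr n k) + i)%N = N by rewrite deg_incr addSn.
have jkn : incr n j <> incr n k.
  by move=> /(congr1 (fun f => f j)); rewrite /incr eqxx (negPf jk); lia.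
have hdk : (0 < deg (incr n k) < N)%N by lia.
have hdj : (0 < deg (incr n j) < N)%N by lia.
have djk : deg (incr n j) = deg (incr n k) by rewrite !deg_incr.
have sub : segment a b `<=` cregion N y1 `&` cregion N y2.
  by move=> _ [t /andP[t0 t1] <-]; split; apply: cregion_conv.
exists y1, y2, f1, f2, a, b; split => //.
  split => // /(congr1 sval) /= E; apply: jkn.
  have : cregion N y1 y1 by apply/region_cregion/region_refl/f1.1.
  by rewrite E => -[_ /(_ _ hdk on2)]; exact: ocell_unique.
move=> x /sub[[tx c1] [_ c2]]; apply/layerP => //; split=> // n' dn' on'.
apply: jkn; rewrite -(ocell_unique _ on' (c1 _ hdj on1)); last by rewrite deg_incr; lia.
by rewrite (ocell_unique _ on' (c2 _ hdk on2)) //; rewrite deg_incr; lia.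
Qed.

End Existence.

(** * Residue fields *)

Section ResidueField.
Variable A : comNzRingType.

Definition is_ideal (J : set A) := [/\ J 0, ~ J 1,
  forall x y, J x -> J y -> J (x + y) & forall a x, J x -> J (a * x)].

(** Maximality in the form needed for [residue]: inverses modulo J. *)
Definition is_maximal (J : set A) := is_ideal J /\
  forall a, ~ J a -> exists b, J (1 - b * a).

Lemma maximal_exists (I : set A) : is_ideal I ->
  exists2 J, is_maximal J & I `<=` J.
Proof.
move=> [I0 I1 ID IM].
(* Zorn's lemma runs over the J whose union with I is an ideal, so that the union of the empty chain
   qualifies. *)
have [F Fch|M [MI Mmax]] := @Zorn_bigcup A (fun J => is_ideal (I `|` J)).
  move=> tot; split; first by left.
  - case=> // -[X FX X1]; have [_ h _ _] := Fch _ FX; by apply: h; right.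
  - move=> x y [Ix|[X FX Xx]] [Iy|[Y FY Yy]].
    + by left; exact: ID.
    + have [_ _ /(_ x y) h _] := Fch _ FY.
      by have [||?|?] := h; [left|right|left|right; exists Y].
    + have [_ _ /(_ x y) h _] := Fch _ FX.
      by have [||?|?] := h; [right|left|left|right; exists X].
    + have [XY|YX] := tot _ _ FX FY.
        have [_ _ /(_ x y) h _] := Fch _ FY.
        by have [||?|?] := h; [right; exact: XY|right|left|right; exists Y].
      have [_ _ /(_ x y) h _] := Fch _ FX.
      by have [||?|?] := h; [right|right; exact: YX|left|right; exists X].
  - move=> a x [Ix|[X FX Xx]]; first by left; exact: IM.
    have [_ _ _ /(_ a x) h] := Fch _ FX.
    by have [|?|?] := h; [right|left|right; exists X].
exists (I `|` M); last by move=> x; left.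
split=> // a naM; apply: contrapT => nex.
have [J0 J1 JD JM] := MI.
pose K : set A := [set x | exists b j, (I `|` M) j /\ x = b * a + j].
have MK : (I `|` M) `<=` K by move=> x Jx; exists 0, x; rewrite mul0r add0r.
have Ka : K a by exists 1, 0; rewrite mul1r addr0.
have KE : I `|` K = K by apply/setUidPr => x Ix; apply: MK; left.
apply: (Mmax K).
  by split=> [x Mx|/(_ _ Ka) Ma]; [apply: MK; right | apply: naM; right].
rewrite KE; split.
- exact: MK.
- move=> [b [j [Jj e]]]; apply: nex; exists b; rewrite e; move: Jj.
  by rewrite addrAC subrr add0r.
- move=> _ _ [b [j [Jj ->]]] [b' [j' [Jj' ->]]]; exists (b + b'), (j + j').
  by split; [exact: JD | rewrite mulrDl addrACA].
- move=> c _ [b [j [Jj ->]]]; exists (c * b), (c * j).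
  by split; [exact: JM | rewrite mulrDr mulrA].
Qed.

Variables (J : set A) (maxJ : is_maximal J).

Definition max_pred of is_maximal J : {pred A} := fun x => `[< J x >].

Lemma max_pred_closed : idealr_closed (max_pred maxJ).
Proof.
have [[J0 J1 JD JM] _] := maxJ; split.
- exact/asboolP.
- exact/asboolP.
- by move=> a x y /asboolP Jx /asboolP Jy; apply/asboolP/JD => //; exact: JM.
Qed.

HB.instance Definition _ := isIdealr.Build A (max_pred maxJ) max_pred_closed.

Definition residue := {ideal_quot (max_pred maxJ)}.
HB.instance Definition _ := GRing.ComNzRing.on residue.

Local Open Scope quotient_scope.

Lemma residue_mulV (x : residue) : x != 0 -> exists y, y * x = 1.
Proof.
rewrite -[x]reprK; set a := repr x => x0.
have [_ /(_ a)[Ja|b Jb]] := maxJ.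
  move: x0; have -> : \pi_residue a = \pi_residue 0.
    by apply/eqP; rewrite -Quotient.idealrBE subr0; exact/asboolP.
  by rewrite rmorph0 eqxx.
exists (\pi_residue b); rewrite -rmorphM -(rmorph1 \pi_residue).
by apply/esym/eqP; rewrite -Quotient.idealrBE; exact/asboolP.
Qed.

Definition residue_inv (x : residue) : residue := xget 0 [set y | y * x = 1].

Lemma residue_mulVf (x : residue) : x != 0 -> residue_inv x * x = 1.
Proof. by move=> /residue_mulV[y yx]; rewrite /residue_inv; case: xgetP => // /(_ y). Qed.

Lemma residue_inv0 : residue_inv 0 = 0.
Proof.
rewrite /residue_inv; case: xgetP => // y _ /= /eqP.
by rewrite mulr0 eq_sym oner_eq0.
Qed.

HB.instance Definition _ :=
  GRing.ComNzRing_isField.Build residue residue_mulVf residue_inv0.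

End ResidueField.

Lemma ideal_residue_field (A : comNzRingType) (I : set A) : is_ideal I ->
  exists (L : fieldType) (phi : {rmorphism A -> L}), forall a, I a -> phi a = 0.
Proof.
move=> /maximal_exists[J maxJ IJ].
exists (residue maxJ), (\pi_(residue maxJ)%qT : {rmorphism A -> residue maxJ}).
move=> a /IJ Ja; rewrite -(rmorph0 (\pi_(residue maxJ)%qT)).
by apply/eqP; rewrite -Quotient.idealrBE subr0; exact/asboolP.
Qed.

(** * Spans of lines *)

Section Submodules.
Variables (A : comUnitRingType) (N : nat).
Implicit Types P Q : set 'cV[A]_N.

Lemma submodule0 : submodule [set (0 : 'cV[A]_N)].
Proof. by split=> [//|v w -> ->|a v ->]; rewrite ?addr0 ?scaler0. Qed.

Lemma submodule_sum P I (r : seq I) (F : I -> 'cV[A]_N) :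
  submodule P -> (forall i, P (F i)) -> P (\sum_(i <- r) F i).
Proof. by move=> [P0 PD _] PF; elim/big_rec: _ => // i x _; exact: PD. Qed.

Lemma submoduleB P v w : submodule P -> P v -> P w -> P (v - w).
Proof. by move=> [_ PD PZ] Pv Pw; rewrite -scaleN1r; apply/PD/PZ. Qed.

Lemma submodule_preim P (B : comUnitRingType) (M : nat) (g : 'cV[B]_M -> 'cV[A]_N)
    (phi : B -> A) : submodule P -> g 0 = 0 -> {morph g : x y / x + y} ->
  (forall a x, g (a *: x) = phi a *: g x) -> submodule [set v | P (g v)].
Proof.
move=> [P0 PD PZ] g0 gD gZ; split=> [|v w|a v] /=; first by rewrite g0.
- by rewrite gD; exact: PD.
- by rewrite gZ; exact: PZ.
Qed.

Lemma submodule_coord (i : 'I_N) : submodule [set v : 'cV[A]_N | v i 0 = 0].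
Proof.
split=> [|v w|a v] /=; rewrite !mxE //; first by move=> -> ->; rewrite addr0.
by move=> ->; rewrite mulr0.
Qed.

Lemma submodule_modulo P (v : 'cV[A]_N) : submodule P ->
  submodule [set w | exists a, P (w - a *: v)].
Proof.
move=> [P0 PD PZ]; split=> [|w w' [a Pa] [a' Pa']|c w [a Pa]] /=.
- by exists 0; rewrite scale0r subr0.
- by exists (a + a'); rewrite scalerDl opprD addrACA; exact: PD.
- by exists (c * a); rewrite -scalerA -scalerBr; exact: PZ.
Qed.

End Submodules.

Section Span.
Variables (A : comUnitRingType) (N : nat) (e : nat -> 'cV[A]_N) (t : nat -> nat -> A).

(* The line attached to the point (N-1-b-c, b, c) of theta_0 is spanned by
   lvec b c; every upward triangle of theta_0 gives one linear relation. *)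
Fixpoint lvec (b c : nat) : 'cV[A]_N :=
  if c is c'.+1 then lvec b c' - t b c' *: lvec b.+1 c' else e b.

(* The subspace attached to the exponents (a, b, c) is spanned by the lines of
   the points of theta_0 dominating (a, b, c). *)
Definition span (a b c : nat) : set 'cV[A]_N := [set w | forall P, submodule P ->
  (forall b' c', b <= b' -> c <= c' -> a + b' + c' < N -> P (lvec b' c'))%N -> P w].

Lemma span_gen a b c b' c' : (b <= b')%N -> (c <= c')%N -> (a + b' + c' < N)%N ->
  span a b c (lvec b' c').
Proof. by move=> hb hc hN P _; apply. Qed.

Lemma span_submodule a b c : submodule (span a b c).
Proof.
split=> [P [] //|v w hv hw P subP hP|x v hv P subP hP].
  by have [_ PD _] := subP; apply: PD; [exact: hv|exact: hw].
by have [_ _ PZ] := subP; apply: PZ; exact: hv.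
Qed.

Lemma span_sub a b c P : submodule P ->
  (forall b' c', b <= b' -> c <= c' -> a + b' + c' < N -> P (lvec b' c'))%N ->
  span a b c `<=` P.
Proof. by move=> sP hP w; apply. Qed.

Lemma span_le a b c a' b' c' : (a <= a')%N -> (b <= b')%N -> (c <= c')%N ->
  span a' b' c' `<=` span a b c.
Proof.
move=> ha hb hc; apply: span_sub; first exact: span_submodule.
by move=> x y hx hy h; apply: span_gen; lia.
Qed.

Lemma span0 a b c : (N <= a + b + c)%N -> span a b c = [set 0].
Proof.
move=> h; apply/seteqP; split=> [|w ->]; last by case: (span_submodule a b c).
apply: span_sub; first exact: submodule0.
by move=> b' c' hb hc h'; lia.
Qed.

End Span.

Lemma lvec_mul (A : comUnitRingType) N (g : 'M[A]_N) e t b c :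
  lvec (fun i => g *m e i) t b c = g *m lvec e t b c.
Proof.
by elim: c b => [//|c IH] b /=; rewrite !IH mulmxBr scalemxAr.
Qed.

Lemma lvec_map (A B : comUnitRingType) N (phi : {rmorphism A -> B})
    (e : nat -> 'cV[A]_N) t b c :
  map_mx phi (lvec e t b c) =
  lvec (fun i => map_mx phi (e i)) (fun b c => phi (t b c)) b c.
Proof.
by elim: c b => [//|c IH] b /=; rewrite map_mxB map_mxZ !IH.
Qed.

Lemma span_mul (A : comUnitRingType) N (g : 'M[A]_N) e t a b c :
  [set g *m v | v in span e t a b c] = span (fun i => g *m e i) t a b c.
Proof.
apply/seteqP; split=> [_ [v hv <-] P sP hP|].
  apply: (hv [set v | P (g *m v)]).
    apply: (@submodule_preim _ _ _ _ _ (mulmx g) id) => //.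
    - exact: mulmx0.
    - exact: mulmxDr.
    - by move=> x y; rewrite scalemxAr.
  by move=> b' c' hb hc h /=; rewrite -lvec_mul; exact: hP.
apply: span_sub => [|b' c' hb hc h].
  have [S0 SD SZ] := span_submodule e t a b c.
  split=> [|_ _ [v hv <-] [w hw <-]|x _ [v hv <-]].
  - by exists 0; rewrite ?mulmx0.
  - by exists (v + w); rewrite ?mulmxDr //; exact: SD.
  - by exists (x *: v); rewrite ?scalemxAr //; exact: SZ.
by exists (lvec e t b' c'); [exact: span_gen | rewrite lvec_mul].
Qed.

Section BaseChangeSpan.
Variables (A B : comUnitRingType) (phi : {rmorphism A -> B}) (N : nat).

Lemma base_change_submodule (P : set 'cV[A]_N) : submodule (base_change phi P).
Proof.
split.
- by exists 0%N, (fun=> 0), (fun=> 0); split=> [[]//|]; rewrite big_ord0.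
- move=> _ _ [n [c [v [Pv ->]]]] [n' [c' [v' [Pv' ->]]]].
  exists (n + n')%N, (fun l : 'I_(n + n') => match fintype.split l with inl i => c i | inr i => c' i end),
    (fun l : 'I_(n + n') => match fintype.split l with inl i => v i | inr i => v' i end); split.
    by move=> l; case: (fintype.split l).
  rewrite big_split_ord /=; congr (_ + _); apply: eq_bigr => l _.
    by case: split_ordP => // j /eqP; rewrite ?eq_lshift ?eq_lrshift // => /eqP ->.
  by case: split_ordP => // j /eqP; rewrite ?eq_rshift ?eq_rlshift // => /eqP ->.
- move=> a _ [n [c [v [Pv ->]]]]; exists n, (fun l => a * c l), v; split => //.
  by rewrite scaler_sumr; apply: eq_bigr => l _; rewrite scalerA.
Qed.

Lemma base_change_map (P : set 'cV[A]_N) v : P v -> base_change phi P (map_mx phi v).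
Proof.
by move=> Pv; exists 1%N, (fun=> 1), (fun=> v); split; rewrite // big_ord1 scale1r.
Qed.

Lemma base_change_sub (P : set 'cV[A]_N) Q : submodule Q ->
  (forall v, P v -> Q (map_mx phi v)) -> base_change phi P `<=` Q.
Proof.
move=> sQ h _ [n [c [v [Pv ->]]]]; apply: submodule_sum => // l.
by have [_ _ QZ] := sQ; apply/QZ/h.
Qed.

Lemma base_change_span e t a b c : base_change phi (span e t a b c) =
  span (fun i => map_mx phi (e i) : 'cV[B]_N) (fun b c => phi (t b c)) a b c.
Proof.
apply/seteqP; split.
  apply: base_change_sub; first exact: span_submodule.
  apply: span_sub => [|b' c' hb hc h] /=.
    apply: (@submodule_preim _ _ _ _ _ (map_mx phi) phi).
    - exact: span_submodule.
    - exact: map_mx0.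
    - exact: map_mxD.
    - exact: map_mxZ.
  by rewrite lvec_map; exact: span_gen.
apply: span_sub => [|b' c' hb hc h]; first exact: base_change_submodule.
rewrite -lvec_map; apply: base_change_map. exact: span_gen.
Qed.

Lemma base_change_gl (g : 'M[A]_N) (P : set 'cV[A]_N) :
  base_change phi [set g *m v | v in P] =
  [set map_mx phi g *m w | w in base_change phi P].
Proof.
apply/seteqP; split.
  apply: base_change_sub => [|_ [v Pv <-]]; last first.
    by exists (map_mx phi v); [exact: base_change_map | rewrite map_mxM].
  have [S0 SD SZ] := base_change_submodule P.
  split=> [|_ _ [v hv <-] [w hw <-]|x _ [v hv <-]].
  - by exists 0; rewrite ?mulmx0.
  - by exists (v + w); rewrite ?mulmxDr //; exact: SD.
  - by exists (x *: v); rewrite ?scalemxAr //; exact: SZ.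
move=> _ [_ [n [c [v [Pv ->]]]] <-]; rewrite mulmx_sumr.
apply: submodule_sum; first exact: base_change_submodule.
move=> l; rewrite -scalemxAr -map_mxM.
have [_ _ SZ] := base_change_submodule [set g *m v | v in P].
by apply: SZ; apply: base_change_map; exists (v l).
Qed.

End BaseChangeSpan.

(** * The normal form over the standard basis *)

Section Standard.
Variables (A : comUnitRingType) (N : nat) (t : nat -> nat -> A).

(** Indexed by natural numbers to fit the recursion of [lvec]; the vector is 0 for b >= N. *)
Definition std (b : nat) : 'cV[A]_N := \col_i (i == b :> nat)%:R.

Local Notation u := (lvec std t).
Local Notation span := (span std t).

(** With the next two lemmas, this is the triangular shape of the frame; the last nonzero coordinate
    of [u b c] is, up to sign, a product of coefficients. *)
Lemma lvec_out b c (i : 'I_N) : (i < b)%N || (b + c < i)%N -> u b c i 0 = 0.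
Proof.
elim: c b => [|c IH] b hi /=; first by rewrite mxE; case: eqP => // E; lia.
rewrite [LHS]mxE [X in _ + X]mxE [X in _ - X]mxE !IH; first by rewrite mulr0 subrr.
  by move: hi; rewrite addSnnS; case/orP => h; rewrite ?h ?orbT // ltnS ltnW.
by case/orP: hi => h; rewrite ?h // orbC; apply/orP; left; lia.
Qed.

Lemma lvec_first b c (i : 'I_N) : i = b :> nat -> u b c i 0 = 1.
Proof.
elim: c b => [|c IH] b hi /=; first by rewrite mxE hi eqxx.
rewrite [LHS]mxE [X in _ + X]mxE [X in _ - X]mxE IH // lvec_out ?mulr0 ?subr0 //.
by rewrite hi leqnn.
Qed.

Hypothesis unit_t : forall b c, t b c \is a GRing.unit.

Lemma lvec_last b c (i : 'I_N) : i = (b + c)%N :> nat -> u b c i 0 \is a GRing.unit.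
Proof.
elim: c b => [|c IH] b hi /=; first by rewrite mxE hi addn0 eqxx unitr1.
rewrite mxE [X in _ + X]mxE [X in _ - X]mxE lvec_out; last by rewrite hi addnS leqnn orbT.
by rewrite sub0r unitrN unitrM unit_t IH // hi addSnnS.
Qed.

Lemma span_low a b c w (i : 'I_N) : span a b c w -> (i < b)%N -> w i 0 = 0.
Proof.
move=> hw ib; apply: (hw [set v | v i 0 = 0]); first exact: submodule_coord.
by move=> b' c' hb hc h /=; rewrite lvec_out // (leq_trans ib).
Qed.

Lemma span_high a b c w (i : 'I_N) : span a b c w -> (N <= a + i)%N -> w i 0 = 0.
Proof.
move=> hw ib; apply: (hw [set v | v i 0 = 0]); first exact: submodule_coord.
by move=> b' c' hb hc h /=; rewrite lvec_out //; apply/orP; right; lia.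
Qed.

(** Same form as the clause of [complete_flag] on consecutive steps, so the two are
    interchangeable. *)
Definition free1 (P Q : set 'cV[A]_N) :=
  P `<=` Q /\ exists2 v, Q v & forall w, Q w -> exists! x : A, P (w - x *: v).

Lemma free1P (P Q : set 'cV[A]_N) (v : 'cV[A]_N) : submodule P -> P `<=` Q -> Q v ->
  (forall w, Q w -> exists x : A, P (w - x *: v)) ->
  (forall x, P (x *: v) -> x = 0) -> free1 P Q.
Proof.
move=> sP PQ Qv ex un; split=> //; exists v => // w /ex[x Px]; exists x; split=> // y Py.
apply/eqP; rewrite -subr_eq0; apply/eqP/un.
have -> : (x - y) *: v = (w - y *: v) - (w - x *: v).
  by rewrite scalerBl opprB [RHS]addrC addrA subrK.
exact: submoduleB.
Qed.

(** Modulo [span a b.+1 c] the recursion of [lvec] does not change the vector, so all the [u b c']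
    of the span are congruent to [u b c]. *)
Lemma span_step_b a b c w : (a + b + c < N)%N -> span a b c w ->
  exists x : A, span a b.+1 c (w - x *: u b c).
Proof.
move=> h; apply: (span_sub (P := [set w | exists x : A, span a b.+1 c (w - x *: u b c)])).
  exact/submodule_modulo/span_submodule.
move=> b' c' hb hc h'.
have [bb|bb] := eqVneq b' b; last first.
  by exists 0; rewrite scale0r subr0; apply: span_gen => //; lia.
rewrite bb in h' *; exists 1; rewrite scale1r {b' hb bb}.
elim: c' hc h' => [|c' IH] hc h'.
  have -> : c = 0%N by lia.
  by rewrite subrr; case: (span_submodule std t a b.+1 0).
have [<-|cc] := eqVneq c c'.+1.
  by rewrite subrr; case: (span_submodule std t a b.+1 c).
rewrite /= addrAC; apply: (@submoduleB _ _ (span a b.+1 c)); first exact: span_submodule.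
  by apply: IH; lia.
have [_ _ SZ] := span_submodule std t a b.+1 c; apply: SZ.
by apply: span_gen; lia.
Qed.

Lemma free_b a b c : (a + b + c < N)%N -> free1 (span a b.+1 c) (span a b c).
Proof.
move=> h; have bN : (b < N)%N by lia.
apply: (@free1P _ _ (u b c)).
- exact: span_submodule.
- exact: span_le.
- by apply: span_gen => //; lia.
- by move=> w; exact: span_step_b.
move=> x hx; have := span_low (i := Ordinal bN) hx (ltnSn b).
by rewrite mxE lvec_first // mulr1.
Qed.

(** Modulo [span a.+1 b c] only the antidiagonal b' + c' = l remains, where the recursion makes
    [u b' c'.+1] a unit multiple of [u b'.+1 c']. The coordinate l, a unit on [v], vanishes on the
    smaller span. *)
Lemma free_a a b c : (a + b + c < N)%N -> free1 (span a.+1 b c) (span a b c).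
Proof.
move=> h; pose l := (N - 1 - a)%N; have lN : (l < N)%N by lia.
pose v := u (l - c) c.
apply: (@free1P _ _ v).
- exact: span_submodule.
- exact: span_le.
- by apply: span_gen => //; lia.
- move=> w; apply: (span_sub (P := [set w | exists x : A, span a.+1 b c (w - x *: v)])).
    exact/submodule_modulo/span_submodule.
  move=> b' c' hb hc h'.
  have [hl|hl] := eqVneq (b' + c')%N l; last first.
    by exists 0; rewrite scale0r subr0; apply: span_gen => //; lia.
  elim: c' b' hb hc h' hl => [|c' IH] b' hb hc h' hl.
    exists 1; have c0 : c = 0%N by lia.
    have lb : (l - c)%N = b' by lia.
    by rewrite scale1r /v lb c0 subrr; case: (span_submodule std t a.+1 b 0).
  have [cc|cc] := eqVneq c c'.+1.
    exists 1; have lb : (l - c)%N = b' by lia.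
    rewrite scale1r /v lb cc.
    by rewrite subrr; case: (span_submodule std t a.+1 b c'.+1).
  have [||||x hx] := IH b'.+1; [lia..|].
  exists (- (t b' c' * x)).
  have -> : u b' c'.+1 - - (t b' c' * x) *: v = u b' c' - t b' c' *: (u b'.+1 c' - x *: v).
    by rewrite /= scaleNr scalerBr scalerA opprK opprB addrA addrAC.
  apply: (@submoduleB _ _ (span a.+1 b c)); first exact: span_submodule.
    by apply: span_gen; lia.
  by have [_ _ SZ] := span_submodule std t a.+1 b c; exact: SZ.
move=> x hx; have := span_high (i := Ordinal lN) hx; rewrite mxE => h0.
have ul : v (Ordinal lN) 0 \is a GRing.unit by apply: lvec_last => /=; lia.
by apply: (mulIr ul); rewrite mul0r; apply: h0 => /=; lia.
Qed.

(** Modulo [span a b c.+1] the recursion makes [u b' c] a multiple of [u b'.+1 c], so the last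
    vector of row c generates. *)
Lemma free_c a b c : (a + b + c < N)%N -> free1 (span a b c.+1) (span a b c).
Proof.
move=> h; pose l := (N - 1 - a - c)%N; have lN : (l < N)%N by lia.
pose v := u l c.
apply: (@free1P _ _ v).
- exact: span_submodule.
- exact: span_le.
- by apply: span_gen => //; lia.
- move=> w; apply: (span_sub (P := [set w | exists x : A, span a b c.+1 (w - x *: v)])).
    exact/submodule_modulo/span_submodule.
  move=> b' c' hb hc h'.
  have [cc|cc] := eqVneq c' c; last first.
    by exists 0; rewrite scale0r subr0; apply: span_gen => //; lia.
  rewrite cc in h' *.
  have [d ld] : exists d, (b' + d = l)%N by exists (l - b')%N; lia.
  elim: d b' hb h' ld => [|d IH] b' hb h' ld.
    exists 1; rewrite scale1r /v -ld addn0 subrr.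
    by case: (span_submodule std t a b c.+1).
  have [|||x hx] := IH b'.+1; [lia..|].
  exists (t b' c * x).
  have -> : u b' c - (t b' c * x) *: v = u b' c.+1 + t b' c *: (u b'.+1 c - x *: v).
    by rewrite /= scalerBr scalerA addrA subrK.
  have [_ SD SZ] := span_submodule std t a b c.+1; apply: SD; last exact: SZ.
  by apply: span_gen; lia.
move=> x hx.
(* The coordinates of [v] below l vanish, so a multiple of it drops into the spans of larger b one
   after the other, until the span is 0. *)
suff : span a l c.+1 (x *: v).
  rewrite span0 /=; last by lia.
  move=> /(congr1 (fun f : 'cV_N => f (Ordinal lN) 0)).
  by rewrite !mxE lvec_first // mulr1.
have [d ld] : exists d, (b + d = l)%N by exists (l - b)%N; lia.
elim: d b h hx ld => [|d IH] b h hx ld; first by rewrite -ld addn0.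
apply: (IH b.+1); [lia| |lia].
have [|y hy] := span_step_b _ hx; first by lia.
have bN : (b < N)%N by lia.
have := span_low (i := Ordinal bN) hy (ltnSn _).
rewrite [LHS]mxE [X in X + _]mxE [X in _ + X]mxE [X in _ - X]mxE.
rewrite lvec_out ?lvec_first //; last by apply/orP; left => /=; lia.
rewrite mulr0 mulr1 sub0r => /eqP; rewrite oppr_eq0 => /eqP y0.
by move: hy; rewrite y0 scale0r subr0.
Qed.

Lemma span_ab_neq a b c : (a + b + c + 1 < N)%N -> span a.+1 b c <> span a b.+1 c.
Proof.
move=> h E; have bN : (b < N)%N by lia.
have hb : span a.+1 b c (u b c) by apply: span_gen; lia.
rewrite E in hb; have := span_low (i := Ordinal bN) hb (ltnSn b).
by rewrite lvec_first // => /eqP; rewrite oner_eq0.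
Qed.

Lemma span_cb_neq a b c : (a + b + c + 1 < N)%N -> span a b c.+1 <> span a b.+1 c.
Proof.
move=> h E; have bN : (b < N)%N by lia.
have hb : span a b c.+1 (u b c.+1) by apply: span_gen; lia.
rewrite E in hb; have := span_low (i := Ordinal bN) hb (ltnSn b).
by rewrite lvec_first // => /eqP; rewrite oner_eq0.
Qed.

Lemma span_ca_neq a b c : (a + b + c + 1 < N)%N -> span a b c.+1 <> span a.+1 b c.
Proof.
move=> h E; pose l := (N - 1 - a)%N; have lN : (l < N)%N by lia.
have hb : span a b c.+1 (u (l - c.+1) c.+1) by apply: span_gen; lia.
rewrite E in hb; have lE : l = (l - c.+1 + c.+1)%N by lia.
have := lvec_last (i := Ordinal lN) lE; rewrite (span_high hb) ?unitr0 //=.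
by rewrite /l; lia.
Qed.

End Standard.

Section Extensionality.
Variables (A : comUnitRingType) (N : nat).

Lemma lvec_ext (e e' : nat -> 'cV[A]_N) t t' b c :
  (forall i, i < N -> e i = e' i)%N ->
  (forall b c, b + c + 1 < N -> t b c = t' b c)%N -> (b + c < N)%N ->
  lvec e t b c = lvec e' t' b c.
Proof.
move=> he ht; elim: c b => [|c IH] b h /=; first by apply: he; lia.
by rewrite !IH ?ht //; lia.
Qed.

Lemma span_ext (e e' : nat -> 'cV[A]_N) t t' a b c :
  (forall i, i < N -> e i = e' i)%N ->
  (forall b c, b + c + 1 < N -> t b c = t' b c)%N ->
  span e t a b c = span e' t' a b c.
Proof.
move=> he ht; apply/seteqP; split; apply: span_sub;
  try exact: span_submodule; move=> b' c' hb hc h.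
  by rewrite (lvec_ext he ht); [exact: span_gen|lia].
by rewrite -(lvec_ext he ht); [exact: span_gen|lia].
Qed.

Lemma line_span (e : nat -> 'cV[A]_N) t b c w : (b + c < N)%N ->
  span e t (N - 1 - b - c) b c w -> exists x, w = x *: lvec e t b c.
Proof.
move=> h; apply: (span_sub (P := [set w | exists x, w = x *: lvec e t b c])).
  split=> [|_ _ [x ->] [y ->]|z _ [x ->]].
  - by exists 0; rewrite scale0r.
  - by exists (x + y); rewrite scalerDl.
  - by exists (z * x); rewrite scalerA.
move=> b' c' hb hc h'; exists 1; rewrite scale1r.
have -> : b' = b by lia.
by have -> : c' = c by lia.
Qed.

End Extensionality.

(** * Matrices carrying one normal form to another *)

Section Rigidity.
Variables (A : comUnitRingType) (N : nat) (s t : nat -> nat -> A) (g : 'M[A]_N).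
Hypotheses (s0 : forall b, s b 0 = 1) (t0 : forall b, t b 0 = 1).
Hypothesis gts : forall b c, (b + c < N)%N ->
  [set g *m v | v in span (@std A N) t (N - 1 - b - c) b c] =
  span (@std A N) s (N - 1 - b - c) b c.

Local Notation ut := (lvec (@std A N) t).
Local Notation us := (lvec (@std A N) s).

Lemma rigid_line b c : (b + c < N)%N ->
  exists2 mu, mu \is a GRing.unit & g *m ut b c = mu *: us b c.
Proof.
move=> h; have bN : (b < N)%N by lia.
have [|mu mE] := @line_span A N (@std A N) s b c (g *m ut b c) h.
  by rewrite -gts //; exists (ut b c) => //; apply: span_gen; lia.
exists mu => //.
have : span (@std A N) s (N - 1 - b - c) b c (us b c) by apply: span_gen; lia.
rewrite -gts // => -[_ /(line_span h)[x ->]]; rewrite -scalemxAr mE scalerA.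
move=> /(congr1 (fun f : 'cV_N => f (Ordinal bN) 0)).
rewrite mxE lvec_first // mulr1 => E; apply/unitrP; exists x.
by rewrite (mulrC mu) E.
Qed.

(** Coordinate b of the transported relation shows that mu(b, c) does not depend on c, and
    coordinate b + 1 that mu(b, c) s = t mu(b+1, c). The normalized row 0 then makes mu constant in
    b as well. *)
Lemma rigid_scale : (0 < N)%N -> exists mu, [/\ mu \is a GRing.unit, g = mu%:M &
  forall b c, (b + c + 1 < N)%N -> t b c = s b c].
Proof.
move=> N0.
have /choice[mu muP] (x : nat * nat) : exists mu, (x.1 + x.2 < N)%N ->
    mu \is a GRing.unit /\ g *m ut x.1 x.2 = mu *: us x.1 x.2.
  have [h|h] := boolP (x.1 + x.2 < N)%N; last by exists 0.
  by have [mu ? ?] := rigid_line h; exists mu.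
have muE b c : (b + c < N)%N -> g *m ut b c = mu (b, c) *: us b c.
  by move=> h; have [] := muP (b, c) h.
have rec b c : (b + c + 1 < N)%N -> mu (b, c.+1) = mu (b, c) /\
    mu (b, c) * s b c = t b c * mu (b.+1, c).
  move=> h; have bN : (b < N)%N by lia.
  have b1N : (b.+1 < N)%N by lia.
  have h0 : (b + c.+1 < N)%N by lia.
  have h1 : (b + c < N)%N by lia.
  have h2 : (b.+1 + c < N)%N by lia.
  have := muE b c.+1 h0; rewrite /= mulmxBr -scalemxAr !muE //.
  set m1 := mu (b, c.+1); set m := mu (b, c); set m' := mu (b.+1, c) => E.
  have mm : m1 = m.
    have := congr1 (fun f : 'cV_N => f (Ordinal bN) 0) E.
    have z : us b.+1 c (Ordinal bN) 0 = 0 by apply: lvec_out; rewrite /= ltnSn.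
    by rewrite !mxE lvec_first // z !mulr0 !subr0 !mulr1.
  split=> //; have := congr1 (fun f : 'cV_N => f (Ordinal b1N) 0) E.
  have y1 : us b.+1 c (Ordinal b1N) 0 = 1 by exact: lvec_first.
  by rewrite mm !mxE y1 !mulr1 mulrBr => /addrI/oppr_inj.
have row0 b : (b < N)%N -> mu (b, 0%N) = mu (0%N, 0%N).
  elim: b => // b IH h; have [|_] := rec b 0%N; first by lia.
  by rewrite s0 t0 mulr1 mul1r => <-; apply: IH; lia.
have mu0 b c : (b + c < N)%N -> mu (b, c) = mu (0%N, 0%N).
  elim: c b => [|c IH] b h; first by apply: row0; lia.
  by have [|-> _] := rec b c; [lia|apply: IH; lia].
have [u0 _] := muP (0%N, 0%N) N0.
exists (mu (0%N, 0%N)); split=> //.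
  apply/matrixP => i j; have := muE j 0%N; rewrite addn0 => /(_ (ltn_ord j)) /=.
  rewrite row0 // => /(congr1 (fun f : 'cV_N => f i 0)).
  rewrite !mxE (bigD1 j) //= !mxE eqxx mulr1 big1 ?addr0 => [->|k kj].
    by rewrite mulr_natr.
  by rewrite mxE val_eqE (negPf kj) mulr0.
move=> b c h; have [_] := rec b c h; rewrite !mu0; [|lia|lia].
by rewrite mulrC => /(mulIr u0).
Qed.

End Rigidity.

(** * Sums of hyperplanes that differ everywhere *)

Section Sum.
Variables (A : comUnitRingType) (N : nat) (P1 P2 Q : set 'cV[A]_N).
Hypotheses (sP1 : submodule P1) (sP2 : submodule P2) (sQ : submodule Q).

(* The image of P2 in Q/P1 = A is an ideal; modulo a maximal ideal containing
   it, P1 and P2 would have the same base change. *)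
Lemma distinct_sum : free1 P1 Q -> free1 P2 Q -> distinct_everywhere P1 P2 ->
  forall w, Q w -> exists p1 p2, [/\ P1 p1, P2 p2 & w = p1 + p2].
Proof.
move=> [P1Q [v1 Qv1 ex1]] [P2Q [v2 Qv2 ex2]] dis.
have [P10 P1D P1Z] := sP1; have [P20 P2D P2Z] := sP2.
have un x : P1 (x *: v1) -> x = 0.
  move=> Px; have [y [_ yU]] := ex1 _ (P1Q _ Px).
  by rewrite -(yU x) ?subrr //; apply: yU; rewrite scale0r subr0.
pose I : set A := [set x | exists2 p, P2 p & P1 (p - x *: v1)].
have [[p Pp Pp1]|nI1] := pselect (I 1).
  move=> w /ex1[x [Px _]]; rewrite scale1r in Pp1.
  exists (w - x *: v1 - x *: (p - v1)), (x *: p); split.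
  - by apply: submoduleB => //; exact: P1Z.
  - exact: P2Z.
  - by rewrite scalerBr opprB addrA subrK subrK.
have [|L [phi phi0]] := @ideal_residue_field A I.
  split=> //.
  - by exists 0; rewrite // scale0r subr0.
  - move=> x y [p Pp Px] [q Pq Py]; exists (p + q); first exact: P2D.
    by rewrite scalerDl opprD addrACA; exact: P1D.
  - move=> a x [p Pp Px]; exists (a *: p); first exact: P2Z.
    by rewrite -scalerA -scalerBr; exact: P1Z.
apply: contrapT => _; apply: (dis L phi).
have IP2 p : P2 p -> exists2 x, I x & P1 (p - x *: v1).
  by move=> Pp; have [x [Px _]] := ex1 p (P2Q _ Pp); exists x => //; exists p.
(* [q] and [z] express each generator by the other, modulo P1 and P2 respectively; their images in L
   are inverse to each other. *)
have [q [Pq _]] := ex1 v2 Qv2.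
have [z [Pz _]] := ex2 v1 Qv1.
have zq : phi z * phi q = 1.
  have [x Ix Px] := IP2 _ Pz.
  have : P1 ((1 - z * q - x) *: v1).
    have -> : (1 - z * q - x) *: v1 = (v1 - z *: v2 - x *: v1) + z *: (v2 - q *: v1).
      by apply/colP => i; rewrite !mxE; ring.
    by apply: P1D => //; exact: P1Z.
  move=> /un/(congr1 phi); rewrite !rmorphB rmorph1 rmorphM rmorph0 (phi0 _ Ix) subr0.
  by move=> /eqP; rewrite subr_eq0 => /eqP.
have q0 : phi q != 0.
  by apply: contraTneq isT => q0; move: zq; rewrite q0 mulr0 => /esym/eqP; rewrite oner_eq0.
(* A vector whose coefficient modulo P dies in L has its image in the base change of P. *)
have map0 (P : set 'cV[A]_N) v x w : submodule P -> P (v - x *: w) -> phi x = 0 ->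
    base_change phi P (map_mx phi v).
  move=> sP Pv x0; have -> : map_mx phi v = map_mx phi (v - x *: w).
    by rewrite map_mxB map_mxZ x0 scale0r subr0.
  exact: base_change_map.
apply/seteqP; split; apply: base_change_sub; try exact: base_change_submodule.
  move=> v Pv; have [y [Py _]] := ex2 v (P1Q _ Pv).
  apply: (map0 _ _ y v2) => //.
  have [x Ix Px] := IP2 _ Py.
  have : P1 ((y * q + x) *: v1).
    have -> : (y * q + x) *: v1 = v - (v - y *: v2 - x *: v1) - y *: (v2 - q *: v1).
      by apply/colP => i; rewrite !mxE; ring.
    by apply: submoduleB => //; [exact: submoduleB|exact: P1Z].
  move=> /un/(congr1 phi); rewrite rmorphD rmorphM rmorph0 (phi0 _ Ix) addr0.
  by move=> /eqP; rewrite mulf_eq0 (negPf q0) orbF => /eqP.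
move=> v Pv; have [x Ix Px] := IP2 _ Pv.
by apply: (map0 _ _ x v1) => //; exact: phi0.
Qed.

End Sum.

(** * Normal form of a system of subspaces *)

Section Frame.
Variables (A : comUnitRingType) (N : nat) (V : nat -> nat -> nat -> set 'cV[A]_N).
Hypothesis subV : forall a b c, submodule (V a b c).
Hypothesis V0 : V 0 0 0 = setT.
Hypothesis VN : forall a b c, (a + b + c = N)%N -> V a b c = [set 0].
Hypothesis free_Va : forall a b c, (a + b + c < N)%N -> free1 (V a.+1 b c) (V a b c).
Hypothesis free_Vb : forall a b c, (a + b + c < N)%N -> free1 (V a b.+1 c) (V a b c).
Hypothesis free_Vc : forall a b c, (a + b + c < N)%N -> free1 (V a b c.+1) (V a b c).
Hypothesis dis_ab : forall a b c, (a + b + c + 1 < N)%N ->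
  distinct_everywhere (V a.+1 b c) (V a b.+1 c).
Hypothesis dis_ac : forall a b c, (a + b + c + 1 < N)%N ->
  distinct_everywhere (V a.+1 b c) (V a b c.+1).
Hypothesis dis_cb : forall a b c, (a + b + c + 1 < N)%N ->
  distinct_everywhere (V a b c.+1) (V a b.+1 c).

Definition gen b c v := V (N - 1 - b - c) b c v /\
  forall w, V (N - 1 - b - c) b c w -> exists! x : A, w = x *: v.

Lemma gen_exists b c : (b + c < N)%N -> exists v, gen b c v.
Proof.
move=> h; have hN : (N - 1 - b - c + b + c < N)%N by lia.
have [_ [v Vv ex]] := free_Va hN; exists v; split=> // w /ex[x [Px xU]].
rewrite VN in Px xU; last by lia.
exists x; split; first by apply/eqP; rewrite -subr_eq0; apply/eqP.
by move=> y wy; apply: xU; rewrite /= wy subrr.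
Qed.

Lemma gen_inj b c v x : gen b c v -> x *: v = 0 -> x = 0.
Proof.
move=> [Vv ex] xv; have [V00 _ _] := subV (N - 1 - b - c) b c.
have [y [_ yU]] := ex 0 V00.
by rewrite -(yU x) // (yU 0) // scale0r.
Qed.

Lemma gen_unit b c v x : x \is a GRing.unit -> gen b c v -> gen b c (x *: v).
Proof.
move=> ux [Vv ex]; have [_ _ VZ] := subV (N - 1 - b - c) b c.
split; first exact: VZ.
move=> w /ex[y [-> yU]]; exists (y / x); split; first by rewrite scalerA divrK.
by move=> z; rewrite scalerA => /yU ->; rewrite mulrK.
Qed.

(** Here V a b c has rank two. With v0 generating its quotient by the line of v1, v2 = s v0 and v0 =
    r v2 modulo that line, so r s = 1 and s can be cancelled. *)
Lemma gen_indep b c v1 v2 x y : (b + c + 1 < N)%N -> gen b c v1 -> gen b.+1 c v2 ->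
  x *: v1 + y *: v2 = 0 -> x = 0 /\ y = 0.
Proof.
move=> h g1 g2 E; pose a := (N - 2 - b - c)%N.
have [V1 e1] := g1; have [V2 e2] := g2.
have E1 : (N - 1 - b - c = a.+1)%N by lia.
have E2 : (N - 1 - b.+1 - c = a)%N by lia.
rewrite E1 in V1 e1; rewrite E2 in V2 e2.
have hN : (a + b + c < N)%N by lia.
have hN1 : (a + b + c + 1 < N)%N by lia.
have fa := free_Va hN; have fb := free_Vb hN.
have S := distinct_sum (subV a.+1 b c) (subV a b.+1 c) fa fb (dis_ab hN1).
have [sub [v0 Vv0 ex0]] := fa.
have un z : V a.+1 b c (z *: v0) -> z = 0.
  move=> Pz; have [z' [_ zU]] := ex0 _ (sub _ Pz).
  by rewrite -(zU z) ?subrr; [apply: zU; rewrite scale0r subr0|have [] := subV a.+1 b c].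
have [s [Ps _]] := ex0 v2 (fb.1 _ V2).
have [p1 [p2 [Vp1 /e2[r [-> _]] Ev0]]] := S v0 Vv0.
have [_ VD VZ] := subV a.+1 b c.
have rs : 1 - r * s = 0.
  apply: un; have -> : (1 - r * s) *: v0 = p1 + r *: (v2 - s *: v0).
    apply/colP => i; have := congr1 (fun f : 'cV_N => f i 0) Ev0.
    rewrite !mxE => /esym/(canRL (addrK _)) ->; ring.
  by apply: VD => //; exact: VZ.
have y0 : y = 0.
  have ys : y * s = 0.
    apply: un; have -> : (y * s) *: v0 = - x *: v1 - y *: (v2 - s *: v0).
      apply/colP => i; have := congr1 (fun f : 'cV_N => f i 0) E.
      rewrite !mxE => e; apply/esym/(@etrans _ _ (y * s * v0 i 0 -
        (x * v1 i 0 + y * v2 i 0))); [ring | by rewrite e subr0].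
    by apply: submoduleB => //; exact: VZ.
  have -> : y = y * (1 - r * s) + r * (y * s) by ring.
  by rewrite rs ys !mulr0 addr0.
split=> //; apply: (gen_inj g1).
by move: E; rewrite y0 scale0r addr0.
Qed.

(** Each of the three lines lies in the sum of the other two. Comparing these relations through
    [gen_indep] shows that both coefficients in v3 = x v1 + z v2 are units. *)
Lemma gen_triangle b c v1 v2 : (b + c + 1 < N)%N -> gen b c v1 -> gen b.+1 c v2 ->
  exists2 y, y \is a GRing.unit & gen b c.+1 (v1 - y *: v2).
Proof.
move=> h g1 g2; pose a := (N - 2 - b - c)%N.
have hN : (a + b + c < N)%N by lia.
have hN1 : (a + b + c + 1 < N)%N by lia.
have [v3 g3] : exists v, gen b c.+1 v by apply: gen_exists; lia.
have [V1 e1] := g1; have [V2 e2] := g2; have [V3 e3] := g3.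
have E1 : (N - 1 - b - c = a.+1)%N by lia.
have E2 : (N - 1 - b.+1 - c = a)%N by lia.
have E3 : (N - 1 - b - c.+1 = a)%N by lia.
rewrite E1 in V1 e1; rewrite E2 in V2 e2; rewrite E3 in V3 e3.
have fa := free_Va hN; have fb := free_Vb hN; have fc := free_Vc hN.
have Sab := distinct_sum (subV a.+1 b c) (subV a b.+1 c) fa fb (dis_ab hN1).
have Sac := distinct_sum (subV a.+1 b c) (subV a b c.+1) fa fc (dis_ac hN1).
have Scb := distinct_sum (subV a b c.+1) (subV a b.+1 c) fc fb (dis_cb hN1).
have [_ [_ [/e1[x [-> _]] /e2[z [-> _]] E]]] := Sab v3 (fc.1 _ V3).
have [_ [_ [/e3[p [-> _]] /e2[q [-> _]] Ev1]]] := Scb v1 (fa.1 _ V1).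
have [_ [_ [/e1[p' [-> _]] /e3[q' [-> _]] Ev2]]] := Sac v2 (fb.1 _ V2).
have [|/eqP px _] := @gen_indep b c v1 v2 (1 - p * x) (- (p * z + q)) h g1 g2.
  apply/colP => i; have := congr1 (fun f : 'cV_N => f i 0) Ev1.
  rewrite E !mxE => e; apply: (@etrans _ _ (v1 i 0 - (p * (x * v1 i 0 + z * v2 i 0)
    + q * v2 i 0))); [ring | by rewrite -e subrr].
have [|_ /eqP qz] := @gen_indep b c v1 v2 (- (p' + q' * x)) (1 - q' * z) h g1 g2.
  apply/colP => i; have := congr1 (fun f : 'cV_N => f i 0) Ev2.
  rewrite E !mxE => e; apply: (@etrans _ _ (v2 i 0 - (p' * v1 i 0 +
    q' * (x * v1 i 0 + z * v2 i 0)))); [ring | by rewrite -e subrr].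
have ux : x \is a GRing.unit.
  by apply/unitrP; exists p; move: px; rewrite subr_eq0 eq_sym (mulrC x) => /eqP.
have uz : z \is a GRing.unit.
  by apply/unitrP; exists q'; move: qz; rewrite subr_eq0 eq_sym (mulrC z) => /eqP.
exists (- (x^-1 * z)); first by rewrite unitrN unitrM unitrV ux.
have -> : v1 - - (x^-1 * z) *: v2 = x^-1 *: v3.
  by rewrite E scalerDr !scalerA mulVr // scale1r scaleNr opprK.
by apply: gen_unit; rewrite ?unitrV.
Qed.

(** The unit from [gen_triangle] is absorbed in the next generator of the row; this is the
    normalization t_(b,0) = 1. *)
Lemma row0_exists : (0 < N)%N -> exists e : nat -> 'cV[A]_N,
  (forall b, b < N -> gen b 0 (e b))%N /\
  (forall b, b.+1 < N -> gen b 1 (e b - e b.+1))%N.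
Proof.
move=> N0; have [v0 g0] : exists v, gen 0 0 v by exact: gen_exists.
have /choice[f fP] (bv : nat * 'cV[A]_N) : exists v', (bv.1.+1 < N)%N ->
    gen bv.1 0 bv.2 -> gen bv.1.+1 0 v' /\ gen bv.1 1 (bv.2 - v').
  have [h|h] := boolP (bv.1.+1 < N)%N; last by exists 0.
  have [g|g] := pselect (gen bv.1 0 bv.2); last by exists 0.
  have [v2 g2] : exists v, gen bv.1.+1 0 v by apply: gen_exists; lia.
  have [|y uy gy] := @gen_triangle bv.1 0 bv.2 v2 _ g g2; first by lia.
  by exists (y *: v2) => _ _; split=> //; exact: gen_unit.
pose e := nat_rect (fun=> 'cV[A]_N) v0 (fun b v => f (b, v)).
have ge b : (b < N)%N -> gen b 0 (e b).
  elim: b => [//|b IH] h; have [] := fP (b, e b) h; last by [].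
  by apply: IH; lia.
exists e; split=> // b h; have gb : gen b 0 (e b) by exact/ge/ltnW.
by have [_] := fP (b, e b) h gb.
Qed.

Lemma coefficients_exist : (0 < N)%N -> exists (e : nat -> 'cV[A]_N) t,
  [/\ forall b c, t b c \is a GRing.unit, forall b, t b 0 = 1 &
      forall b c, (b + c < N)%N -> gen b c (lvec e t b c)].
Proof.
move=> N0; have [e [e0 e1]] := row0_exists N0.
(* The default 1, when the arguments are not generators, keeps every coefficient a unit. *)
have /choice[f fP] (x : nat * nat * ('cV[A]_N * 'cV[A]_N)) : exists y,
    y \is a GRing.unit /\ let: (b, c, (v1, v2)) := x in (b + c + 1 < N)%N ->
    gen b c v1 -> gen b.+1 c v2 -> gen b c.+1 (v1 - y *: v2).
  case: x => [[b c] [v1 v2]].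
  have [h|h] := boolP (b + c + 1 < N)%N; last first.
    by exists 1; split=> //; exact: unitr1.
  have [g1|g1] := pselect (gen b c v1); last by exists 1; split=> //; exact: unitr1.
  have [g2|g2] := pselect (gen b.+1 c v2); last by exists 1; split=> //; exact: unitr1.
  by have [y uy gy] := gen_triangle h g1 g2; exists y.
pose T c (r : nat -> 'cV[A]_N) b := if c is 0%N then 1 else f (b, c, (r b, r b.+1)).
pose r := nat_rect (fun=> nat -> 'cV[A]_N) e
  (fun c r b => r b - T c r b *: r b.+1).
pose t b c := T c (r c) b.
have rE c b : lvec e t b c = r c b.
  by elim: c b => [//|c IH] b /=; rewrite !IH.
have ut b c : t b c \is a GRing.unit.
  by rewrite /t /T; case: c => [|c]; [exact: unitr1|case: (fP (b, c.+1, (r c.+1 b, r c.+1 b.+1)))].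
exists e, t; split=> // b c; rewrite rE.
elim: c b => [|c IH] b h; first by apply: e0; lia.
have g1 : gen b c (r c b) by apply: IH; lia.
have g2 : gen b.+1 c (r c b.+1) by apply: IH; lia.
case: c IH h g1 g2 => [|c] IH h g1 g2.
  by rewrite /= scale1r; apply: e1; lia.
have [_] := fP (b, c.+1, (r c.+1 b, r c.+1 b.+1)).
by apply => //; lia.
Qed.

Lemma V_le a b c a' b' c' : (a <= a')%N -> (b <= b')%N -> (c <= c')%N ->
  (a' + b' + c' <= N)%N -> V a' b' c' `<=` V a b c.
Proof.
move=> ha hb hc h; have -> : a' = (a + (a' - a))%N by lia.
have -> : b' = (b + (b' - b))%N by lia.
have -> : c' = (c + (c' - c))%N by lia.
have : (a + (a' - a) + (b + (b' - b)) + (c + (c' - c)) <= N)%N by lia.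
move: (a' - a)%N (b' - b)%N (c' - c)%N => x y z {a' b' c' ha hb hc h} h.
apply: (@subset_trans _ (V a (b + y) (c + z))).
  elim: x h => [|x IH] h; first by rewrite addn0.
  rewrite addnS; apply: subset_trans (IH _); last by lia.
  by apply: (free_Va _).1; lia.
apply: (@subset_trans _ (V a b (c + z))).
  elim: y h => [|y IH] h; first by rewrite addn0.
  rewrite addnS; apply: subset_trans (IH _); last by lia.
  by apply: (free_Vb _).1; lia.
elim: z h => [|z IH] h; first by rewrite addn0.
rewrite addnS; apply: subset_trans (IH _); last by lia.
by apply: (free_Vc _).1; lia.
Qed.

(** Induction on the rank d: from rank two on, V a b c is the sum of V a.+1 b c and V a b.+1 c. *)
Lemma V_span e t : (forall b c, (b + c < N)%N -> gen b c (lvec e t b c)) ->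
  forall a b c, (a + b + c <= N)%N -> V a b c = span e t a b c.
Proof.
move=> ge a b c h; apply/seteqP; split; last first.
  apply: span_sub => // b' c' hb hc h'.
  have hbc : (b' + c' < N)%N by lia.
  by have [Vl _] := ge b' c' hbc; apply: V_le Vl; lia.
have [d hd] : exists d, (a + b + c + d = N)%N by exists (N - (a + b + c))%N; lia.
elim: d a b c h hd => [|d IH] a b c h hd.
  rewrite addn0 in hd; rewrite VN // => _ ->.
  by have [S0 _ _] := span_submodule e t a b c.
case: d IH hd => [|d] IH hd.
  have hbc : (b + c < N)%N by lia.
  have [_ ex] := ge b c hbc; have E : (N - 1 - b - c = a)%N by lia.
  rewrite E in ex; move=> w /ex[x [-> _]].
  have [_ _ SZ] := span_submodule e t a b c; apply: SZ.
  by apply: span_gen => //; lia.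
have hN : (a + b + c < N)%N by lia.
have hN1 : (a + b + c + 1 < N)%N by lia.
move=> w /(distinct_sum (subV a.+1 b c) (subV a b.+1 c) (free_Va hN) (free_Vb hN)
  (dis_ab hN1))[p1 [p2 [V1 V2 ->]]].
have [_ SD _] := span_submodule e t a b c; apply: SD.
  apply: (span_le (a' := a.+1) (b' := b) (c' := c)) => //.
  by apply: IH V1; lia.
apply: (span_le (a' := a) (b' := b.+1) (c' := c)) => //.
by apply: IH V2; lia.
Qed.

Lemma frame_exists : (0 < N)%N -> exists (g : 'M[A]_N) t,
  [/\ g \in unitmx, forall b c, t b c \is a GRing.unit, forall b, t b 0 = 1 &
      forall a b c, (a + b + c <= N)%N ->
        V a b c = [set g *m v | v in span (@std A N) t a b c]].
Proof.
move=> N0; have [e [t [ut t0 ge]]] := coefficients_exist N0.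
pose g : 'M[A]_N := \matrix_(i, j) e j i 0.
have gstd i : (i < N)%N -> g *m std A N i = e i.
  move=> iN; apply/colP => l; rewrite mxE (bigD1 (Ordinal iN)) //= !mxE eqxx mulr1.
  rewrite big1 ?addr0 // => j ji; rewrite !mxE.
  have -> : (j == i :> nat) = false by apply: contraNF ji.
  by rewrite mulr0.
have VE a b c : (a + b + c <= N)%N ->
    V a b c = [set g *m v | v in span (@std A N) t a b c].
  by move=> h; rewrite (V_span ge h) span_mul; apply: span_ext => // i /gstd.
exists g, t; split=> //.
(* The columns of [g] generate V 0 0 0, the whole module, so [g] has a right inverse. *)
have /choice[H HP] (j : 'I_N) : exists v : 'cV[A]_N, g *m v = delta_mx j 0.
  have : V 0 0 0 (delta_mx j 0) by rewrite V0.
  by rewrite VE // => -[v _ <-]; exists v.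
suff : g *m (\matrix_(i, j) H j i 0) = 1%:M by move=> /mulmx1_unit[].
apply/matrixP => i j; have := congr1 (fun f : 'cV_N => f i 0) (HP j).
rewrite !mxE => E; rewrite -[RHS](_ : (i == j)%:R = _) //.
transitivity (\sum_k g i k * H j k 0).
  by apply: eq_bigr => k _; rewrite !mxE.
by rewrite E eqxx andbT.
Qed.

End Frame.

(** * Indexing the free coefficients *)

Section TorusCoordinates.
Variable N : nat.
Local Notation d := 'C(N - 1, 2).

Definition torus_indices : seq (nat * nat) :=
  [seq (b, c) | c <- iota 1 (N - 2), b <- iota 0 (N - 1 - c)].

Lemma mem_torus_indices b c : ((b, c) \in torus_indices) = (0 < c)%N && (b + c + 1 < N)%N.
Proof.
apply/allpairsPdep/idP => [[c' [b' []]]|/andP[c0 h]].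
  by rewrite !mem_iota => h1 h2 [-> ->]; lia.
by exists c, b; rewrite !mem_iota; split=> //; lia.
Qed.

Lemma size_torus_indices : size torus_indices = d.
Proof.
rewrite size_allpairs_dep -bin2_sum sumnE big_map.
under eq_bigr do rewrite size_iota.
have -> : iota 1 (N - 2) = index_iota 1 (N - 1) by rewrite /index_iota; congr iota; lia.
case: (N - 1)%N => [|M]; first by rewrite !big_nil.
rewrite [RHS]big_ltn // add0n big_nat_rev /=.
by apply: eq_big_nat => c; lia.
Qed.

Lemma uniq_torus_indices : uniq torus_indices.
Proof.
apply: allpairs_uniq_dep; [exact: iota_uniq|by move=> c _; exact: iota_uniq|].
by move=> [c b] [c' b'] _ _ /= [-> ->].
Qed.

Variable A : comUnitRingType.
Implicit Types tau : 'rV[A]_d.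

(* The coefficients of the row c = 0 are normalized to 1, which is also the junk
   value outside the triangle of indices. *)
Definition coef tau (b c : nat) : A :=
  oapp (tau 0) 1 (insub (index (b, c) torus_indices)).

Lemma coef_unit tau b c : torus tau -> coef tau b c \is a GRing.unit.
Proof. by move=> ht; rewrite /coef; case: insub => [i|] /=; rewrite ?unitr1. Qed.

Lemma coef0 tau b : coef tau b 0 = 1.
Proof.
rewrite /coef insubN // -leqNgt -size_torus_indices leqNgt index_mem.
by rewrite mem_torus_indices.
Qed.

Lemma coef_row (t : nat -> nat -> A) b c : (forall b, t b 0 = 1) -> (b + c + 1 < N)%N ->
  coef (\row_j let x := nth (0%N, 0%N) torus_indices j in t x.1 x.2) b c = t b c.
Proof.
move=> t0 h; case: c h => [|c] h; first by rewrite coef0.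
have m : (b, c.+1) \in torus_indices by rewrite mem_torus_indices.
have hi : (index (b, c.+1) torus_indices < d)%N by rewrite -size_torus_indices index_mem.
by rewrite /coef insubT /= mxE /= nth_index.
Qed.

Lemma coef_inj tau tau' :
  (forall b c, (b + c + 1 < N)%N -> coef tau b c = coef tau' b c) -> tau = tau'.
Proof.
move=> h; apply/rowP => j; set x := nth (0%N, 0%N) torus_indices j.
have js : (j < size torus_indices)%N by rewrite size_torus_indices.
have : x \in torus_indices by exact: mem_nth.
have := index_uniq (0%N, 0%N) js uniq_torus_indices; rewrite -/x.
case: x => b c E; rewrite mem_torus_indices => /andP[_ /h].
rewrite /coef E insubT //= => hj.
have -> : (Sub (nat_of_ord j) hj : 'I_d) = j by exact: val_inj.
by [].
Qed.

End TorusCoordinates.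

Lemma coef_map N (A B : comUnitRingType) (phi : {rmorphism A -> B})
    (tau : 'rV[A]_('C(N - 1, 2))) b c :
  coef (map_mx phi tau) b c = phi (coef tau b c).
Proof.
by rewrite /coef; case: insub => [i|] /=; rewrite ?mxE ?rmorph1.
Qed.

Lemma std_map (A B : comUnitRingType) (phi : {rmorphism A -> B}) N b :
  map_mx phi (std A N b) = std B N b.
Proof. by apply/colP => i; rewrite !mxE rmorph_nat. Qed.

(** * The moduli space *)

Lemma ord3E (j : 'I_3) : [\/ j = 0, j = 1 | j = 2%:R].
Proof. exact: (@ord3_cases 0 1 2%:R). Qed.

Section Exponents.
Variables (A : comUnitRingType) (N : nat).
Implicit Types (n : 'I_3 -> nat).

Definition nspan (t : nat -> nat -> A) n := span (std A N) t (n 0) (n 1) (n 2%:R).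

Lemma deg012 n : deg n = (n 0%R + n 1%R + n 2%:R%R)%N.
Proof. exact: (@deg3 n 0 1 2%:R). Qed.

Lemma incrE n (j l : 'I_3) : incr n j l = if l == j then (n l).+1 else n l.
Proof. by rewrite /incr; case: eqP => _; rewrite ?addn1 ?addn0. Qed.

Lemma free_nspan t n j : (forall b c, t b c \is a GRing.unit) -> (deg n < N)%N ->
  free1 (nspan t (incr n j)) (nspan t n).
Proof.
rewrite deg012 /nspan => ut h.
by have [->|->|->] := ord3E j; rewrite !incrE /=;
  [exact: free_a | exact: free_b | exact: free_c].
Qed.

Lemma nspan_neq t n j k : (forall b c, t b c \is a GRing.unit) ->
  (deg n + 1 < N)%N -> j != k -> nspan t (incr n j) <> nspan t (incr n k).
Proof.
rewrite deg012 /nspan => ut h; have [->|->|->] := ord3E j;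
  have [->|->|->] := ord3E k => // _; rewrite !incrE /=.
- exact: span_ab_neq.
- by move/esym; exact: span_ca_neq.
- by move/esym; exact: span_ab_neq.
- by move/esym; exact: span_cb_neq.
- exact: span_ca_neq.
- exact: span_cb_neq.
Qed.

Lemma nspan_setT t n : deg n = 0%N -> nspan t n = setT.
Proof.
rewrite deg012 => h; have n0 : n 0 = 0%N by lia.
have n1 : n 1 = 0%N by lia.
have n2 : n 2%:R = 0%N by lia.
rewrite /nspan n0 n1 n2.
apply/seteqP; split=> // w _.
have -> : w = \sum_i w i 0 *: std A N i.
  apply/colP => i; rewrite summxE (bigD1 i) //= !mxE eqxx mulr1 big1 ?addr0 // => j ji.
  by rewrite !mxE val_eqE eq_sym (negPf ji) mulr0.
apply: (@submodule_sum _ _ (span (std A N) t 0 0 0)) => [|i].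
  exact: span_submodule.
have [_ _ SZ] := span_submodule (std A N) t 0 0 0; apply: SZ.
by rewrite -[std A N i]/(lvec (std A N) t i 0); apply: span_gen => //; rewrite addn0 add0n.
Qed.

Lemma nspan0 t n : (N <= deg n)%N -> nspan t n = [set 0].
Proof. by rewrite deg012; exact: span0. Qed.

End Exponents.
Arguments nspan {A} N t n.

Lemma base_change_nspan (A B : comUnitRingType) (phi : {rmorphism A -> B}) N t n :
  base_change phi (nspan N t n) = nspan N (fun b c => phi (t b c)) n.
Proof.
rewrite /nspan base_change_span; apply: span_ext => // i _; exact: std_map.
Qed.

Lemma nspan_distinct (A : comUnitRingType) N (t : nat -> nat -> A) n j k :
  (forall b c, t b c \is a GRing.unit) -> (deg n + 1 < N)%N -> j != k ->
  distinct_everywhere (nspan N t (incr n j)) (nspan N t (incr n k)).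
Proof.
move=> ut h jk L phi; rewrite !base_change_nspan; apply: nspan_neq => // b c.
exact: rmorph_unit.
Qed.

(** * The assignment attached to a system of coefficients *)

Section Codes.
Variables (R : realType) (N : nat).
Implicit Types (F : face R N) (n : 'I_3 -> nat) (y : 'rV[R]_3).

Definition rep F : 'rV[R]_3 := projT1 (cid (face_ofP F)).

Lemma rep_off F : exists oy : off N (rep F), F = face_of oy.
Proof. exact: projT2 (cid (face_ofP F)). Qed.

(* At level i = 0 the cells carry no information and the choice is irrelevant. *)
Definition code F (i : nat) : 'I_3 -> nat :=
  xget (fun=> 0%N) [set n | (deg n + i)%N = N /\ ((0 < i)%N -> ocell n (rep F))].

Lemma codeP F i : (i <= N)%N ->
  (deg (code F i) + i)%N = N /\ ((0 < i)%N -> ocell (code F i) (rep F)).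
Proof.
move=> iN; rewrite /code; case: xgetP => [n -> //|none]; exfalso.
have [oy _] := rep_off F.
have [i0|i0] := boolP (i == 0)%N.
  have [n dn _] := ccell_exists N (rep F).
  by apply: (none n); split; rewrite (eqP i0) ?addn0.
have [iN'|iN'] := boolP (i == N)%N.
  apply: (none (fun=> 0%N)); split=> [|_ j k _ //].
  by rewrite /deg big1 // (eqP iN').
have hd : (0 < N - i < N)%N by lia.
have [n dn on] := NgraphPn oy.1 oy.2 hd.
by apply: (none n); split=> //; lia.
Qed.

Lemma code_face n i y (oy : off N y) : (0 < i < N)%N -> (deg n + i)%N = N ->
  ocell n y -> code (face_of oy) i = n.
Proof.
move=> hi dn on; have iN : (i <= N)%N by lia.
have [dc oc] := codeP (face_of oy) iN; have [orep E] := rep_off (face_of oy).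
have : cregion N (rep (face_of oy)) y.
  by rewrite -[cregion _ _]/(sval (face_of orep)) -E; apply/region_cregion/region_refl/oy.1.
move=> [_ /(_ (code (face_of oy) i)) cy]; apply/esym/(ocell_unique _ on); first by lia.
by apply: cy; [lia|apply: oc; lia].
Qed.

Variable A : comUnitRingType.

Definition model (t : nat -> nat -> A) : flag_assignment R N A :=
  fun F i => nspan N t (code F i).

(** Across a segment of layer i the exponents differ by [share_layer] while their closed cells meet,
    so they are n0 + e_k and n0 + e_j and [nspan_distinct] applies. Across a segment missing the
    layer they are equal. *)
Lemma model_framed t : (forall b c, t b c \is a GRing.unit) -> framed_moduli (model t).
Proof.
move=> ut; split=> [F|F1 F2 a b share i hi].
  have leN (i : 'I_N.+1) : (i <= N)%N by rewrite -ltnS.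
  split.
  - by apply: nspan0; have [] := codeP F (leN ord0); rewrite addn0 => ->.
  - by apply: nspan_setT; have [] := codeP F (leN ord_max); rewrite /=; lia.
  - by move=> i; exact: span_submodule.
  move=> i j ij; have [di oi] := codeP F (leN i); have [dj oj] := codeP F (leN j).
  have jN := leN j.
  suff [l El] : exists l, model t F i = nspan N t (incr (code F j) l).
    by rewrite El; apply: free_nspan => //; lia.
  have [i0|i0] := boolP (0 < i)%N.
    have [||l El] := @ocell_nested R (code F j) (code F i) (rep F) _ (oj _) (oi i0).
    - lia.
    - lia.
    by exists l; rewrite /model El.
  (* At i = 0 both subspaces are 0, so any index serves. *)
  exists 0; rewrite /model !nspan0 ?deg_incr //; lia.
have [ry1 E1] := rep_off F1; have [ry2 E2] := rep_off F2.
have iN : (i <= N)%N by lia.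
have [d1 c1] := codeP F1 iN; have [d2 c2] := codeP F2 iN.
have i0 : (0 < i)%N by case/andP: hi.
have hd : (0 < N - i < N)%N by lia.
rewrite E1 E2 in share; split=> [lay|dis]; last first.
  have [n [dn on1 on2]] := share_off_layer hi share dis.
  rewrite /model -(ocell_unique _ on1 (ocellW (c1 i0))); last by lia.
  by rewrite -(ocell_unique _ on2 (ocellW (c2 i0))) //; lia.
have neq : code F1 i <> code F2 i.
  by move=> E; apply: (share_layer hi d1 (c1 i0) _ share lay); rewrite E; exact: c2.
have [_ _ sub] := share.
have [|[_ ca1] [_ ca2]] := sub a _.
  by exists 0; rewrite /= ?lexx ?ler01 // scale0r addr0.
have [||||j [k [m [/and3P[jk jm km] ej ek em _]]]] :=
  @ccell_adjacent R (code F1 i) (code F2 i) a.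
- lia.
- exact: neq.
- by apply: ca1; [lia|exact: c1].
- by apply: ca2; [lia|exact: c2].
pose n0 : 'I_3 -> nat := fun l => (code F1 i l - (l == k))%N.
have En1 : code F1 i = incr n0 k.
  by apply/funext => l; rewrite /n0 incrE; case: eqVneq => [->|_]; lia.
have En2 : code F2 i = incr n0 j.
  apply/funext => l; rewrite /n0 incrE.
  by have [->|->|->] := ord3_cases l jk jm km;
    rewrite ?eqxx ?(negPf jk) 1?eq_sym ?(negPf jk) ?(negPf jm) 1?eq_sym ?(negPf km) ?(negPf jm); lia.
rewrite /model En1 En2; apply: nspan_distinct => //; last by rewrite eq_sym.
by move: d1; rewrite En1 deg_incr; lia.
Qed.

End Codes.

(** * From an assignment of flags to a system of subspaces *)

Section Strata.
Variables (R : realType) (N : nat) (A : comUnitRingType) (x : flag_assignment R N A).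
Hypotheses (N2 : (2 <= N)%N) (fx : framed_moduli x).
Implicit Types (n : 'I_3 -> nat) (y : 'rV[R]_3) (i : 'I_N.+1).

(** Steps 0 and N are the same in every flag; between them this is [phi_const]. *)
Lemma flag_cell n i y1 y2 (f1 : off N y1) (f2 : off N y2) : (deg n + i)%N = N ->
  ((0 < i)%N -> ocell n y1) -> ((0 < i)%N -> ocell n y2) ->
  x (face_of f1) i = x (face_of f2) i.
Proof.
move=> dn c1 c2; have iN : (i <= N)%N by rewrite -ltnS.
have [cf sh] := fx; have [z1 t1 _ _] := cf (face_of f1); have [z2 t2 _ _] := cf (face_of f2).
have [i0|i0] := boolP (i == 0%N :> nat).
  by have -> : i = ord0 by [apply/val_inj/eqP]; rewrite z1 z2.
have [iN'|iN'] := boolP (i == N :> nat).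
  by have -> : i = ord_max by [apply/val_inj/eqP]; rewrite t1 t2.
have hi : (0 < i < N)%N by lia.
apply: (@phi_const R N _ (fun F => x F i) i n hi dn) => //.
- by move=> F1 F2 a b share dis; apply: (sh _ _ _ _ share i hi).2.
- by apply: c1; lia.
- by apply: c2; lia.
Qed.

(* The flags determine no subspace for deg n > N; setT is a junk value. *)
Definition stratum n : set 'cV[A]_N := if (deg n <= N)%N then
  [set w | exists y (oy : off N y) i, [/\ (deg n + i)%N = N,
     (0 < i)%N -> ocell n y & x (face_of oy) i w]] else setT.

Lemma stratumE n i y (oy : off N y) : (deg n + i)%N = N ->
  ((0 < i)%N -> ocell n y) -> stratum n = x (face_of oy) i.
Proof.
move=> dn on; rewrite /stratum; have -> : (deg n <= N)%N by lia.
apply/seteqP; split=> w; last by move=> xw; exists y, oy, i.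
move=> [y' [oy' [i' [dn' on' xw]]]]; have ii : i' = i by apply: val_inj => /=; lia.
by rewrite ii in on' xw; rewrite (flag_cell oy oy' dn).
Qed.

Lemma stratum_exists n : (deg n <= N)%N ->
  exists y (oy : off N y) i, (deg n + i)%N = N /\ ((0 < i)%N -> ocell n y).
Proof.
move=> h; have iN : (N - deg n < N.+1)%N by lia.
have [n0|n0] := boolP (deg n == N).
  have e0 : (0 < 1)%N by [].
  (* Degree N imposes no cell condition, so any point off the graph will do; the auxiliary exponent
     (N-1, 0, 0) supplies one. *)
  have [|y [oy _ _]] := @nested_point R N N2 1 (fun l => if l == 0 then (N - 1)%N else 0%N) 0 e0.
    by rewrite deg012 /=; lia.
  by exists y, oy, (Ordinal iN) => /=; split; lia.
have [||y [oy on _]] := @nested_point R N N2 (N - deg n) n 0; [lia|lia|].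
by exists y, oy, (Ordinal iN) => /=; split=> //; lia.
Qed.

Lemma stratum_submodule n : submodule (stratum n).
Proof.
have [h|h] := boolP (deg n <= N)%N; last by rewrite /stratum (negPf h).
have [y [oy [i [dn on]]]] := stratum_exists h.
by rewrite (stratumE oy dn on); have [_ _ s _] := fx.1 (face_of oy).
Qed.

Lemma stratum_free n j : (deg n < N)%N -> free1 (stratum (incr n j)) (stratum n).
Proof.
move=> h; have i0 : (0 < N - deg n)%N by lia.
have [|y [oy on on']] := @nested_point R N N2 (N - deg n) n j i0; first by lia.
have iN : (N - deg n < N.+1)%N by lia.
have jN : ((N - deg n).-1 < N.+1)%N by lia.
rewrite (@stratumE n (Ordinal iN) y oy) /=; [|lia|by []].
rewrite (@stratumE (incr n j) (Ordinal jN) y oy) /=.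
- have [_ _ _ step] := fx.1 (face_of oy); apply: step => /=; lia.
- by rewrite deg_incr; lia.
- by move=> h'; apply: on'; lia.
Qed.

Lemma stratum_distinct n j k : (deg n + 1 < N)%N -> j != k ->
  distinct_everywhere (stratum (incr n j)) (stratum (incr n k)).
Proof.
move=> h jk; pose i := (N - 1 - deg n)%N; have iN : (i < N.+1)%N by lia.
have i0 : (0 < i)%N by lia.
have dn : (deg n + i).+1 = N by lia.
have [y1 [y2 [f1 [f2 [a [b [on1 on2 share lay]]]]]]] := @adjacent_faces R N N2 i n j k i0 dn jk.
rewrite (@stratumE _ (Ordinal iN) y1 f1) /=; [|by rewrite deg_incr; lia|by []].
rewrite (@stratumE _ (Ordinal iN) y2 f2) /=; [|by rewrite deg_incr; lia|by []].
by have [_ sh] := fx; apply: (sh _ _ _ _ share (Ordinal iN) _).1 => //=; lia.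
Qed.

Lemma stratum0 n : (deg n == 0)%N -> stratum n = setT.
Proof.
move=> /eqP h; have [|y [oy [i [dn on]]]] := @stratum_exists n; first by lia.
rewrite (stratumE oy dn on); have -> : i = ord_max by apply: val_inj => /=; lia.
by have [] := fx.1 (face_of oy).
Qed.

Lemma stratumN n : deg n = N -> stratum n = [set 0].
Proof.
move=> h; have [|y [oy [i [dn on]]]] := @stratum_exists n; first by lia.
rewrite (stratumE oy dn on); have -> : i = ord0 by apply: val_inj => /=; lia.
by have [] := fx.1 (face_of oy).
Qed.

Definition expo (a b c : nat) : 'I_3 -> nat :=
  fun l => if l == 0 then a else if l == 1 then b else c.

Lemma expo_incr a b c : [/\ incr (expo a b c) 0 = expo a.+1 b c,
  incr (expo a b c) 1 = expo a b.+1 c & incr (expo a b c) 2%:R = expo a b c.+1].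
Proof.
by split; apply/funext => l; rewrite incrE /expo; have [->|->|->] := ord3E l.
Qed.

Lemma deg_expo a b c : deg (expo a b c) = (a + b + c)%N.
Proof. by rewrite deg012. Qed.

Lemma expoE n : expo (n 0) (n 1) (n 2%:R) = n.
Proof. by apply/funext => l; rewrite /expo; have [->|->|->] := ord3E l. Qed.

Lemma model_exists : exists (g : 'M[A]_N) t,
  [/\ g \in unitmx, forall b c, t b c \is a GRing.unit, forall b, t b 0 = 1 &
      x = assignment_act g (model t)].
Proof.
have [||||||||||g [t [ug ut t0 E]]] :=
  @frame_exists A N (fun a b c => stratum (expo a b c)).
- by move=> a b c; exact: stratum_submodule.
- by apply: stratum0; rewrite deg_expo.
- by move=> a b c h; apply: stratumN; rewrite deg_expo.
- move=> a b c h; have [<- _ _] := expo_incr a b c.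
  by apply: stratum_free; rewrite deg_expo.
- move=> a b c h; have [_ <- _] := expo_incr a b c.
  by apply: stratum_free; rewrite deg_expo.
- move=> a b c h; have [_ _ <-] := expo_incr a b c.
  by apply: stratum_free; rewrite deg_expo.
- move=> a b c h; have [<- <- _] := expo_incr a b c.
  by apply: stratum_distinct; rewrite ?deg_expo.
- move=> a b c h; have [<- _ <-] := expo_incr a b c.
  by apply: stratum_distinct; rewrite ?deg_expo.
- move=> a b c h; have [_ <- <-] := expo_incr a b c.
  by apply: stratum_distinct; rewrite ?deg_expo.
- by lia.
exists g, t; split=> //; apply/funext => F; apply/funext => i.
have iN : (i <= N)%N by rewrite -ltnS.
have [dc oc] := codeP F iN; have [oy EF] := rep_off F.
rewrite {1}EF -(stratumE oy dc oc) -(expoE (code F i)) E.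
  by [].
by rewrite -deg012; lia.
Qed.

End Strata.

(** * The group action and the coordinates *)

Section Action.
Variables (R : realType) (N : nat) (A : comUnitRingType).
Implicit Types (x : flag_assignment R N A) (g h : 'M[A]_N).

Lemma act_mul g h x : assignment_act g (assignment_act h x) = assignment_act (g *m h) x.
Proof.
apply/funext => F; apply/funext => i; apply/seteqP; split.
  by move=> _ [_ [v xv <-] <-]; exists v; rewrite ?mulmxA.
by move=> _ [v xv <-]; exists (h *m v); [exists v|rewrite mulmxA].
Qed.

Lemma act_inv g x y : g \in unitmx -> assignment_act g x = y ->
  x = assignment_act (invmx g) y.
Proof.
move=> ug <-; rewrite act_mul mulVmx //.
apply/funext => F; apply/funext => i; apply/seteqP; split.
  by move=> v xv; exists v; rewrite ?mul1mx.
by move=> _ [v xv <-]; rewrite mul1mx.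
Qed.

(** The lines F^1 suffice, since every exponent of degree N - 1 is the code of some face at level
    1. *)
Lemma model_rigid s t g : (2 <= N)%N -> (forall b, s b 0 = 1) -> (forall b, t b 0 = 1) ->
  assignment_act g (@model R N A t) = model s ->
  exists mu, [/\ mu \is a GRing.unit, g = mu%:M &
    forall b c, (b + c + 1 < N)%N -> t b c = s b c].
Proof.
move=> N2 s0 t0 E; apply: rigid_scale => //; last by lia.
move=> b c h; pose n := expo (N - 1 - b - c) b c.
have dn : (deg n + 1)%N = N by rewrite deg_expo; lia.
have [y [oy on _]] := @nested_point R N N2 1 n 0 isT dn.
have N1 : (1 < N.+1)%N by lia.
have := congr1 (fun x => x (face_of oy) (Ordinal N1)) E.
by rewrite /assignment_act /gl_act /model (code_face oy _ dn on) //; lia.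
Qed.

End Action.

Lemma base_change_act (R : realType) N (A B : comUnitRingType) (phi : {rmorphism A -> B})
    (g : 'M[A]_N) t :
  assignment_base_change phi (assignment_act g (@model R N A t)) =
  assignment_act (map_mx phi g) (@model R N B (fun b c => phi (t b c))).
Proof.
apply/funext => F; apply/funext => i.
by rewrite /assignment_base_change /assignment_act /gl_act base_change_gl base_change_nspan.
Qed.

Section Coordinates.
Variables (R : realType) (N : nat) (A : comUnitRingType).
Hypothesis N2 : (2 <= N)%N.
Implicit Types (x : flag_assignment R N A) (tau : 'rV[A]_('C(N - 1, 2))).

Definition has_coordinates x tau :=
  torus tau /\ exists2 g, g \in unitmx & x = assignment_act g (model (coef tau)).

Definition coordinates x := xget 0 (has_coordinates x).

Lemma has_coordinates_exists x : framed_moduli x -> exists tau, has_coordinates x tau.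
Proof.
move=> /(model_exists N2)[g [t [ug ut t0 E]]].
exists (\row_j let y := nth (0%N, 0%N) (torus_indices N) j in t y.1 y.2).
split=> [j|]; first by rewrite mxE.
exists g => //; rewrite E; congr assignment_act.
apply/funext => F; apply/funext => i; apply: span_ext => // b c h.
by rewrite coef_row.
Qed.

(** This turns the choice made in [coordinates] into a natural and invariant function. *)
Lemma has_coordinates_unique x tau tau' :
  has_coordinates x tau -> has_coordinates x tau' -> tau = tau'.
Proof.
move=> [_ [g ug E]] [_ [g' ug' E']]; move: E'; rewrite E => /(act_inv ug).
rewrite act_mul => /esym/(model_rigid N2 (coef0 _) (coef0 _))[_ [_ _ h]].
by apply/esym/coef_inj.
Qed.

Lemma coordinatesE x tau : has_coordinates x tau -> coordinates x = tau.
Proof.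
move=> h; rewrite /coordinates; case: xgetP => [tau' _ h'|/(_ tau)//].
exact: has_coordinates_unique h' h.
Qed.

Lemma coordinatesP x : framed_moduli x -> has_coordinates x (coordinates x).
Proof. by move=> /has_coordinates_exists[tau h]; rewrite (coordinatesE h). Qed.

End Coordinates.

Theorem theorem1p9 (R : realType) (N : nat) (hN : (2 <= N)%N) (k : fieldType) :
  exists f : forall A : comUnitAlgType k,
      flag_assignment R N A -> 'rV[A]_('C(N - 1, 2)),
    quotient_iso_torus f.
Proof.
exists (fun A => @coordinates R N A); split.
- by move=> A x /(coordinatesP hN)[].
(* Base change carries a normal form of x to a normal form, and its coordinates are unique. *)
- move=> A B phi x /(coordinatesP hN); set tau := coordinates x => -[ht [g ug E]].
  apply: coordinatesE => //; split=> [j|]; first by rewrite mxE rmorph_unit.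
  exists (map_mx phi g); first by rewrite unitmxE det_map_mx rmorph_unit // -unitmxE.
  rewrite E base_change_act; congr assignment_act.
  by congr model; apply/funext => b; apply/funext => c; rewrite coef_map.
- move=> A x y fx fy; have [tx [g ug Ex]] := coordinatesP hN fx.
  have [ty [h uh Ey]] := coordinatesP hN fy; split=> [E|[l [ul Exy]]].
    exists (h *m invmx g); split; first by rewrite unitmx_mul uh unitmx_inv.
    by rewrite -act_mul -(act_inv ug (esym Ex)) E.
  apply/esym/coordinatesE => //; split=> //; exists (l *m g); first by rewrite unitmx_mul ul.
  by rewrite -act_mul -Ex.
- move=> A x y g h fx fy [ug Eg] [uh Eh].
  have [tx [l ul Ex]] := coordinatesP hN fx.
  (* g^-1 h stabilizes x, so its conjugate by l stabilizes the model and is scalar; conjugation back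
     does not change a scalar. *)
  have : assignment_act (invmx l *m (invmx g *m h) *m l) (model (coef (coordinates x))) =
      model (coef (coordinates x)) :> flag_assignment R N A.
    rewrite -!act_mul -Ex Eh -Eg -(act_inv ug erefl).
    exact/esym/(act_inv ul)/esym.
  move=> /(model_rigid hN (coef0 _) (coef0 _))[mu [umu E _]].
  exists mu => //.
  have : invmx g *m h = mu%:M.
    set X := invmx g *m h in E *.
    have -> : X = l *m (invmx l *m X *m l) *m invmx l.
      by rewrite !mulmxA mulmxV // mul1mx -mulmxA mulmxV // mulmx1.
    by rewrite E scalar_mxC -mulmxA mulmxV // mulmx1.
  by move=> /(congr1 (mulmx g)); rewrite mulKVmx // scalar_mxC mul_scalar_mx.
- move=> A tau ht; exists (model (coef tau)).
    by apply: model_framed => b c; exact: coef_unit.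
  apply: coordinatesE => //; split=> //; exists 1%:M; first exact: unitmx1.
  apply/funext => F; apply/funext => i; apply/seteqP; split.
    by move=> v xv; exists v; rewrite ?mul1mx.
  by move=> _ [v xv <-]; rewrite mul1mx.
Qed.
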